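(* Let $n,m\geq 1$ be integers, let $X$ be a metric space, let $A\subset\mathbb{R}^{n+m}$ be a Lebesgue measurable set with positive Lebesgue measure, and let $f:A\to X$ be a Lipschitz mapping. Suppose that $\Theta^{*n}(f,x)>0$ for almost every $x\in A$. Then $f^{-1}(z)$ is countably $\mathcal{H}^m$-rectifiable for $\mathcal{H}^n$-almost all $z\in X$.
   Context: $\omega_n$ is the volume of the unit ball in $\mathbb{R}^n$. $\mathcal{H}^n$ is the $n$-dimensional Hausdorff measure, normalized so that it equals Lebesgue measure on $\mathbb{R}^n$. The Hausdorff content of a subset $E$ of a metric space is $$ \mathcal{H}^n_\infty(E)=\inf\frac{\omega_n}{2^n}\sum_{i=1}^\infty(\operatorname{diam}A_i)^n, $$ where the infimum is over all countable coverings $E\subset\bigcup_{i=1}^\infty A_i$. For a measurable set $A\subset\mathbb{R}^{k}$, a mapping $f:A\to X$ into a metric space, and $x\in A$, the upper $n$-density of $f$ at $x$ is $$ \Theta^{*n}(f,x)=\limsup_{r\to0}\frac{\mathcal{H}^n_\infty(f(B(x,r)\cap A))}{\omega_n r^n}, $$ where $B(x,r)$ is the Euclidean ball. A set $E\subset\mathbb{R}^{n+m}$ is countably $\mathcal{H}^m$-rectifiable if there are sets $E_i\subset\mathbb{R}^m$ and Lipschitz mappings $f_i:E_i\to\mathbb{R}^{n+m}$, $i\in\mathbb{N}$, such that $\mathcal{H}^m\big(E\setminus\bigcup_{i=1}^\infty f_i(E_i)\big)=0$. *)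

(* Defs.v *)
From HB Require Import structures.
From mathcomp Require Import all_boot all_order all_algebra.
From mathcomp Require Import all_classical all_reals all_analysis.
From mathcomp Require Import ring.

Set Implicit Arguments.
Unset Strict Implicit.
Unset Printing Implicit Defensive.

Import Order.TTheory GRing.Theory Num.Theory.
Import numFieldNormedType.Exports.

Local Open Scope classical_set_scope.
Local Open Scope ring_scope.

(* R^n with its Euclidean distance.  The library's metric structure on 'rV[R]_n
   is that of the sup norm, so the Euclidean one is put on an alias; [ball] at
   type [euclidean R n] is the open Euclidean ball. *)
Definition euclidean (R : realType) (n : nat) : Type := 'rV[R]_n.

HB.instance Definition _ (R : realType) (n : nat) :=
  Choice.copy (euclidean R n) 'rV[R]_n.

Definition euclidean_dist (R : realType) (n : nat) (x y : euclidean R n) : R :=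
  Num.sqrt (\sum_(i < n) (x ord0 i - y ord0 i) ^+ 2).

Section euclidean_metric.
Variables (R : realType) (n : nat).
Implicit Types (x y z : euclidean R n) (a b : 'I_n -> R).

Let sqr_sum_ge0 a : 0 <= \sum_i a i ^+ 2.
Proof. by apply: sumr_ge0 => i _; exact: sqr_ge0. Qed.

Let cauchy_schwarz a b :
  (\sum_i a i * b i) ^+ 2 <= (\sum_i a i ^+ 2) * (\sum_i b i ^+ 2).
Proof.
set C := \sum_i a i * b i; set P := \sum_i a i ^+ 2; set Q := \sum_i b i ^+ 2.
have [Q0|Q0] := eqVneq Q 0.
  have b0 i : b i = 0.
    apply/eqP; rewrite -sqrf_eq0; apply/eqP.
    apply: (psumr_eq0P (P := xpredT) (F := fun i => b i ^+ 2)) => // j _.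
    exact: sqr_ge0.
  rewrite Q0 mulr0 /C big1 ?expr0n// => i _.
  by rewrite b0 mulr0.
have Qgt0 : 0 < Q by rewrite lt_def Q0 sqr_sum_ge0.
have : 0 <= \sum_i (Q * a i - C * b i) ^+ 2 by exact: sqr_sum_ge0.
have -> : \sum_i (Q * a i - C * b i) ^+ 2 = Q * (P * Q - C ^+ 2).
  transitivity (\sum_i (Q ^+ 2 * a i ^+ 2 - (Q * C *+ 2) * (a i * b i)
                        + C ^+ 2 * b i ^+ 2)).
    by apply: eq_bigr => i _; ring.
  by rewrite big_split /= sumrB -!mulr_sumr -/C -/P -/Q; ring.
by rewrite pmulr_rge0// subr_ge0.
Qed.

Let edistxx x : euclidean_dist x x = 0.
Proof.
by rewrite /euclidean_dist big1 ?sqrtr0// => i _; rewrite subrr expr0n.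
Qed.

Let edist_positivity x y : euclidean_dist x y = 0 -> x = y.
Proof.
move/eqP; rewrite sqrtr_eq0 => le0; apply/rowP => i.
apply/eqP; rewrite -subr_eq0 -sqrf_eq0; apply/eqP.
apply: (psumr_eq0P (P := xpredT)
  (F := fun i => (x ord0 i - y ord0 i) ^+ 2)) => //.
  by move=> j _; exact: sqr_ge0.
by apply/eqP; rewrite eq_le le0 sqr_sum_ge0.
Qed.

Let edist_sym x y : euclidean_dist x y = euclidean_dist y x.
Proof.
by rewrite /euclidean_dist; congr Num.sqrt; apply: eq_bigr => i _; rewrite -sqrrN opprB.
Qed.

Let edist_triangle y x z : euclidean_dist x z <= euclidean_dist x y + euclidean_dist y z.
Proof.
pose a i := x ord0 i - y ord0 i; pose b i := y ord0 i - z ord0 i.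
have S0 : 0 <= euclidean_dist x y + euclidean_dist y z by rewrite addr_ge0// sqrtr_ge0.
rewrite -[leRHS]ger0_norm// -sqrtr_sqr ler_wsqrtr// sqrrD !sqr_sqrtr//.
have -> : \sum_i (x ord0 i - z ord0 i) ^+ 2 =
    \sum_i a i ^+ 2 + (\sum_i a i * b i) *+ 2 + \sum_i b i ^+ 2.
  rewrite -sumrMnl -!big_split /=; apply: eq_bigr => i _.
  by rewrite -sqrrD /a /b addrA addrNK.
rewrite lerD2r lerD2l lerMn2r/=.
apply: le_trans (ler_norm _) _.
rewrite -sqrtr_sqr -sqrtrM//; apply: ler_wsqrtr.
exact: cauchy_schwarz.
Qed.

HB.instance Definition _ := @isMetric.Build R (euclidean R n)
  (@euclidean_dist R n) edistxx edist_positivity edist_sym edist_triangle.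

End euclidean_metric.

Section lebesgue.
Variables (R : realType) (n : nat).
Implicit Types (a b : nat -> 'rV[R]_n) (A : set (euclidean R n)).

Definition box (u v : 'rV[R]_n) : set (euclidean R n) :=
  [set x | forall i, u ord0 i <= x ord0 i <= v ord0 i].

Definition box_volume (u v : 'rV[R]_n) : R :=
  \prod_(i < n) (v ord0 i - u ord0 i).

(* For n >= 1 boxes may be degenerate, hence finite covers are included. *)
Definition lebesgue_outer A : \bar R :=
  ereal_inf [set s | exists a b,
    [/\ forall k i, a k ord0 i <= b k ord0 i,
        A `<=` \bigcup_k box (a k) (b k) &
        s = (\sum_(0 <= k <oo) (box_volume (a k) (b k))%:E)%E]].

Definition lebesgue_measurable A : Prop := lebesgue_outer.-caratheodory A.

End lebesgue.

Definition omega (R : realType) (n : nat) : R :=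
  fine (lebesgue_outer (@ball R (euclidean R n) (0 : 'rV[R]_n) 1)).

Section hausdorff.
Variables (R : realType) (X : metricType R).
Implicit Types (E : set X) (A : nat -> set X).
Local Open Scope ereal_scope.

(* [maxe 0] only matters for the empty set, where the supremum is -oo. *)
Definition diam E : \bar R :=
  maxe 0 (ereal_sup [set (mdist p.1 p.2)%:E | p in E `*` E]).

(* Intended for n >= 1, so that empty sets A i contribute 0. *)
Definition cover_size (n : nat) A : \bar R :=
  (omega R n / 2 ^+ n)%:E * \sum_(0 <= i <oo) (diam (A i)) ^+ n.

Definition hausdorff_content (n : nat) E : \bar R :=
  ereal_inf [set cover_size n A | A in [set A | E `<=` \bigcup_i A i]].

Definition hausdorff_premeasure (n : nat) (delta : R) E : \bar R :=
  ereal_inf [set cover_size n A | A in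
    [set A | E `<=` \bigcup_i A i /\ forall i, diam (A i) <= delta%:E]].

Definition hausdorff_measure (n : nat) E : \bar R :=
  ereal_sup [set hausdorff_premeasure n delta E | delta in [set d : R | (0 < d)%R]].

End hausdorff.

Definition lipschitz_within (R : realType) (X Y : metricType R)
    (A : set X) (f : X -> Y) : Prop :=
  exists L : R, forall x y, A x -> A y ->
    mdist (f x) (f y) <= L * mdist x y.

Definition upper_density (R : realType) (k : nat) (X : metricType R) (n : nat)
    (A : set (euclidean R k)) (f : euclidean R k -> X) (x : euclidean R k) :
    \bar R :=
  limf_esup (fun r : R => hausdorff_content n (f @` (ball x r `&` A))
                          * ((omega R n * r ^+ n)^-1)%:E)%E 0^'+.

Definition countably_rectifiable (R : realType) (k m : nat)
    (E : set (euclidean R k)) : Prop :=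
  exists (E_ : nat -> set (euclidean R m))
         (f_ : nat -> euclidean R m -> euclidean R k),
    (forall i, lipschitz_within (E_ i) (f_ i)) /\
    hausdorff_measure m (E `\` \bigcup_i (f_ i @` E_ i)) = 0%E.

(* Main.v *)
(* A Lipschitz map on [A] pulls the distance of [X] back to a pseudometric, which is
   glued to the multiple [L] of the norm to give a Lipschitz pseudometric [D] on
   all of [R^(n+m)].  For a fixed direction [v] the difference quotients of [D] along
   dyadic cells form, up to a summable error, a bounded submartingale, so they converge
   almost everywhere; combined with the fact that almost no point of a set sees holes
   of the set at its own scale, this yields metric differentiability of [D] at almost
   every [x], in all directions.  The directions in which [D] vanishes to first order
   form a linear space.  If its dimension exceeds [m], the image of a ball of radius [r]
   is covered by N^(n-1) sets of diameter O(r/N), so the upper [n]-density at [x] is [0].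
   Otherwise [m] coordinates separate it from [0], and by compactness the level set
   through [x] is, seen from [x], a Lipschitz graph over these coordinates; the good
   points split into countably many pieces on which this holds uniformly.  The remaining
   points form a null set, whose fibres are H^m-null over H^n-almost every [z] by an
   Eilenberg inequality. *)
Require Import Defs.
From mathcomp Require Import all_boot all_order all_algebra.
From mathcomp Require Import all_classical all_reals all_analysis.
From mathcomp Require Import ring lra.
Import Order.TTheory GRing.Theory Num.Theory.
Import numFieldNormedType.Exports.
Local Open Scope classical_set_scope.
Local Open Scope ring_scope.

Set Implicit Arguments.
Unset Strict Implicit.
Unset Printing Implicit Defensive.

(** * Countable covers with weights *)

(** Null sets are handled by explicit countable covers, and [covered] serves three families: boxes
    with volume, cells of a tree with relative weight, arbitrary sets with a power of the diameter.
    On trees, both the density statement and submartingale convergence reduce to one stopping rule: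
    if every visit to an event lets [P] be recovered at a proportion [theta < 1] of the weight, and
    each point of [P] makes infinitely many visits, then [theta ^+ j] suffices for all j. The sets
    on which slopes are uniformly stable come with no measurability, so density points are replaced
    by points at which a set is not porous; almost every point of any set is such. The obstacle to
    differentiability is that convergence concerns only segments crossing a cell from its corner.
    Nonporosity carries the resulting upper bound to all short segments near [x]. For the lower
    bound, of two grids shifted by 1/3 against each other, one has [x] and [x + s *: v] in the same
    slab. Estimates use the sup norm; the Euclidean distance enters only for [f], the density and
    the fibres. *)

Definition covered (R : realType) (T I : Type) (S : I -> set T) (w : I -> \bar R)
    (P : set T) (a : \bar R) : Prop :=
  exists u : nat -> I,
    P `<=` \bigcup_k S (u k) /\ (\sum_(0 <= k <oo) w (u k) <= a)%E.

Section covered.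
Variables (R : realType) (T I : Type) (S : I -> set T) (w : I -> \bar R).
Hypothesis w_ge0 : forall i, (0 <= w i)%E.

Lemma covered_sub P Q a b :
  covered S w P a -> Q `<=` P -> (a <= b)%E -> covered S w Q b.
Proof.
move=> [u [Pu ua]] QP ab; exists u; split; first exact: subset_trans Pu.
exact: le_trans ab.
Qed.

Lemma covered_bigcup (P : nat -> set T) (a : nat -> \bar R) :
  (forall k, covered S w (P k) (a k)) ->
  covered S w (\bigcup_k P k) (\sum_(0 <= k <oo) a k)%E.
Proof.
move=> /choice[u uP].
have /card_esym/ppcard_eqP[f] := card_nat2.
exists (fun k => u (f k).1 (f k).2); split.
  move=> x [k _ /(proj1 (uP k))[l _ xl]].
  by exists (f^-1%FUN (k, l)) => //=; rewrite invK ?inE.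
rewrite nneseries_esumT; last by move=> n; exact: w_ge0.
have <- : \esum_(k in [set: nat * nat]) w (u k.1 k.2) =
    \esum_(n in [set: nat]) w (u (f n).1 (f n).2).
  by apply: (@reindex_esum R nat (nat * nat)%type setT setT f (fun k => w (u k.1 k.2))).
rewrite (_ : [set: nat * nat] = [set: nat] `*`` (fun=> setT)); last first.
  by apply/seteqP; split.
rewrite -(@esum_esum R nat nat setT (fun=> setT) (fun i j => w (u i j)))//.
rewrite -nneseries_esumT; last by move=> k; apply: esum_ge0.
apply: lee_nneseries.
  by move=> k _ _; apply: esum_ge0.
move=> k _; rewrite -nneseries_esumT//; exact: (proj2 (uP k)).
Qed.

Hypothesis (i0 : I) (w_i0 : w i0 = 0%E).

Lemma eseries_finite (f : nat -> \bar R) N : (forall k, (0 <= f k)%E) ->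
  (forall k, (N <= k)%N -> f k = 0%E) ->
  (\sum_(0 <= k <oo) f k = \sum_(k < N) f k)%E.
Proof.
move=> f0 fN; rewrite (nneseries_split 0 N)// add0n big_mkord eseries0 ?adde0//.
by move=> k Nk _; exact: fN.
Qed.

Lemma covered1 i : covered S w (S i) (w i).
Proof.
exists (fun k => if k is 0%N then i else i0); split; first by move=> x ?; exists 0%N.
by rewrite (@eseries_finite _ 1) ?big_ord1//; case.
Qed.

Lemma covered0 a : (0 <= a)%E -> covered S w set0 a.
Proof.
move=> a0; exists (fun=> i0); split => //.
by rewrite eseries0.
Qed.

Lemma covered_finite (J : finType) (P : J -> set T) (a : J -> \bar R) :
  (forall j, (0 <= a j)%E) ->
  (forall j, covered S w (P j) (a j)) ->
  covered S w (\bigcup_j P j) (\sum_j a j)%E.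
Proof.
move=> a0 Pa.
pose e (k : nat) : option J := omap enum_val (insub k : option 'I_#|J|).
pose P' k := if e k is Some j then P j else set0.
pose a' k := if e k is Some j then a j else 0%E.
have : covered S w (\bigcup_k P' k) (\sum_(0 <= k <oo) a' k)%E.
  apply: covered_bigcup => k; rewrite /P' /a'; case: (e k) => //.
  exact: covered0.
move/covered_sub; apply.
  move=> x [j _ xj]; exists (enum_rank j) => //.
  by rewrite /P' /e valK /= enum_rankK.
rewrite (@eseries_finite _ #|J|).
- rewrite (reindex_onto enum_rank enum_val)/=; last by move=> k _; exact: enum_valK.
  under eq_bigl do rewrite enum_rankK eqxx.
  apply: lee_sum => j _; by rewrite /a' /e valK /= enum_rankK.
- by move=> k; rewrite /a'; case: (e k).
- by move=> k Jk; rewrite /a' /e insubN// -leqNgt.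
Qed.

Definition null P := forall e : R, 0 < e -> covered S w P e%:E.

Lemma null_sub P Q : null P -> Q `<=` P -> null Q.
Proof. by move=> P0 QP e /P0 /covered_sub; apply. Qed.

Lemma null_bigcup (P : nat -> set T) : (forall k, null (P k)) -> null (\bigcup_k P k).
Proof.
move=> P0 e e0; apply: covered_sub (fun _ h => h) (epsilon_trick0 xpredT (ltW e0)).
by apply: covered_bigcup => k; apply: P0; rewrite divr_gt0.
Qed.

Lemma null_bigcup_count (J : countType) (P : J -> set T) :
  (forall j, null (P j)) -> null (\bigcup_j P j).
Proof.
move=> P0; apply: (@null_sub (\bigcup_k
    (if unpickle k is Some j then P j else set0))).
  apply: null_bigcup => k; case: unpickle => // e e0.
  by apply: covered0; rewrite lee_fin ltW.
by move=> x [j _ xj]; exists (pickle j) => //; rewrite pickleK.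
Qed.

Lemma nullU P Q : null P -> null Q -> null (P `|` Q).
Proof.
move=> P0 Q0; apply: null_sub (null_bigcup_count (P := fun b : bool => if b then P else Q) _) _.
  by case.
by move=> x [Px|Qx]; [exists true|exists false].
Qed.

End covered.

(** Each set of a cover is covered in turn, at rate [C] and only inside [Q]. With [Q] the set under
    study and [C < 1] this is the step iterated to reach weight 0; with [Q = setT] it compares the
    null sets of two families. *)
Lemma covered_trans (R : realType) (T I I' : Type) (S : I -> set T)
    (w : I -> \bar R) (S' : I' -> set T) (w' : I' -> \bar R) (C : R) P Q a :
  (forall i, 0 <= w i)%E -> (forall i, 0 <= w' i)%E ->
  (0 <= C)%R -> covered S w P a ->
  (forall i, covered S' w' (Q `&` S i) (C%:E * w i)%E) ->
  covered S' w' (Q `&` P) (C%:E * a)%E.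
Proof.
move=> w0 w0' C0 [u [Pu ua]] Sw.
have /covered_sub := covered_bigcup w0' (fun k => Sw (u k)); apply.
  by move=> x [Qx /Pu[k _ xk]]; exists k.
rewrite nneseriesZl//; exact: lee_wpmul2l.
Qed.

(** * Stopping on trees of cells *)

Section tree.
Variables (R : realType) (T : Type) (C : countType) (B : finType) (b0 : B).
Variables (cell : nat -> T -> C) (child : nat -> C -> B -> C).
Hypothesis cellS : forall k x, exists b, cell k.+1 x = child k (cell k x) b.

Let N : R := #|B|%:R.

(* [None] stands for the empty set, so that finite covers can be padded. *)
Definition tree_set (i : option (nat * C)) : set T :=
  if i is Some (k, c) then [set x | cell k x = c] else set0.

(** Relative volume: the [#|B|] children of a cell share its weight equally. *)
Definition tree_weight (i : option (nat * C)) : \bar R :=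
  if i is Some (k, c) then (#|B|%:R ^- k)%:E else 0%E.

Let N_gt0 : 0 < N.
Proof. by rewrite ltr0n; apply/card_gt0P; exists b0. Qed.

Let NX_gt0 k : 0 < N ^- k. Proof. by rewrite invr_gt0 exprn_gt0. Qed.

Lemma tree_weight_ge0 i : (0 <= tree_weight i)%E.
Proof. by case: i => [[k c]|]//=; rewrite lee_fin ltW. Qed.
Hint Resolve tree_weight_ge0 : core.

Local Notation tcovered := (covered tree_set tree_weight).

Section stopping.
Variable F : nat -> C -> Prop.

(* Proportion of the cell [c] of level [k] filled by the descendants at depth [h]
   that are the first on their branch to satisfy [F]. *)
Fixpoint first_hit_mass (h k : nat) (c : C) : R :=
  if `[< F k c >] then (h == 0%N)%:R
  else if h is h'.+1 then N^-1 * \sum_b first_hit_mass h' k.+1 (child k c b)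
  else 0.

Definition stopped_mass H k c := \sum_(h < H) first_hit_mass h k c.

Lemma first_hit_mass_ge0 h k c : 0 <= first_hit_mass h k c.
Proof.
elim: h k c => [|h IH] k c /=; case: asboolP => //= _.
by rewrite mulr_ge0 ?invr_ge0 ?(ltW N_gt0)// sumr_ge0.
Qed.

Lemma stopped_massS H k c : stopped_mass H.+1 k c =
  if `[< F k c >] then 1 else N^-1 * \sum_b stopped_mass H k.+1 (child k c b).
Proof.
rewrite /stopped_mass big_ord_recl /=; case: asboolP => Fkc.
  by rewrite big1 ?addr0// => i _ /=.
rewrite add0r exchange_big /= mulr_sumr; apply: eq_bigr => i _ /=.
by [].
Qed.

Lemma stopped_mass_le1 H k c : stopped_mass H k c <= 1.
Proof.
elim: H k c => [|H IH] k c; first by rewrite /stopped_mass big_ord0.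
rewrite stopped_massS; case: asboolP => // _.
rewrite ler_pdivrMl// mulr1 /N -sum1_card natr_sum.
by apply: ler_sum => b _.
Qed.

(** Optional stopping: stop each branch at its first visit to [F] before depth [H]. The mean of [g]
    at the stopping time is at least its value at the root, at most [q] on the stopped part and at
    most [M] on the rest. Solved for the stopped mass, this bounds it from above when [q < M]. *)
Lemma stopped_submartingale (g : nat -> C -> R) (q M : R) :
  (forall k c, g k c <= M) -> (forall k c, F k c -> g k c <= q) ->
  (forall k c, g k c <= N^-1 * \sum_b g k.+1 (child k c b)) ->
  forall H k c, g k c <= q * stopped_mass H k c + M * (1 - stopped_mass H k c).
Proof.
move=> gM gq gsub; elim=> [|H IH] k c.
  by rewrite /stopped_mass big_ord0 mulr0 subr0 mulr1 add0r.
rewrite stopped_massS; case: asboolP => Fkc.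
  by rewrite subrr mulr0 addr0 mulr1 gq.
apply: le_trans (gsub k c) _.
rewrite ler_pdivrMl//.
apply: (@le_trans _ _ (\sum_b (M + (q - M) * stopped_mass H k.+1 (child k c b)))).
  apply: ler_sum => b _; apply: le_trans (IH _ _) _.
  by rewrite le_eqVlt; apply/orP; left; apply/eqP; ring.
rewrite big_split /= sumr_const -mulr_sumr.
set s := \sum_i _; rewrite -mulr_natr -/N.
rewrite le_eqVlt; apply/orP; left; apply/eqP.
by field; rewrite gt_eqF.
Qed.

Definition first_hit (h k : nat) (c : C) : set T :=
  [set x | [/\ cell k x = c, F (k + h) (cell (k + h) x) &
    forall i, (i < h)%N -> ~ F (k + i) (cell (k + i) x)]].

Section stage.
Variables (P : set T) (theta : R).
Hypotheses (theta_ge0 : 0 <= theta)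
  (F_covered : forall k c, F k c ->
     tcovered (P `&` [set x | cell k x = c]) (theta * N ^- k)%:E).

(** A first hit below a cell that does not satisfy [F] is a first hit below one of its children, and
    the masses of the children average to that of the cell. *)
Lemma covered_first_hit h k c :
  tcovered (P `&` first_hit h k c) (theta * first_hit_mass h k c * N ^- k)%:E.
Proof.
have c0 : tcovered set0 0 by exact: (@covered0 _ _ _ _ _ None).
elim: h k c => [|h IH] k c /=; case: asboolP => Fkc.
- rewrite mulr1; have /covered_sub := F_covered Fkc; apply => //.
  by move=> x [Px []].
- rewrite mulr0 mul0r; have /covered_sub := c0; apply => //.
  by move=> x [Px [/= xc]]; rewrite addn0 xc.
- rewrite mulr0 mul0r; have /covered_sub := c0; apply => //.
  by move=> x [Px [/= xc _ /(_ 0%N isT)]]; rewrite addn0 xc.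
- have m0 b : (0 <= (theta * first_hit_mass h k.+1 (child k c b) * N ^- k.+1)%:E)%E.
    by rewrite lee_fin !mulr_ge0 ?first_hit_mass_ge0// ltW.
  have /covered_sub := @covered_finite R _ _ tree_set tree_weight
    tree_weight_ge0 None erefl B _ _ m0 (fun b => IH k.+1 (child k c b)); apply.
  + move=> x [Px [xc Fx nFx]]; have [b xb] := cellS k x.
    exists b => //; split=> //; split.
    * by rewrite xb xc.
    * by rewrite addSnnS.
    * by move=> i ih; rewrite addSnnS; apply: nFx.
  + rewrite sumEFin lee_fin -mulr_suml -mulr_sumr -!mulrA ler_wpM2l//.
    rewrite mulrCA ler_wpM2l//.
      by rewrite sumr_ge0// => b _; exact: first_hit_mass_ge0.
    by rewrite exprS invfM.
Qed.

(** First-hit masses at different depths add up, so a bound on the stopped mass uniform in [H]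
    bounds the cost of covering all points that are ever stopped. *)
Lemma covered_stopped (M : R) k c : (forall H, stopped_mass H k c <= M) ->
  tcovered (P `&` [set x | cell k x = c /\ exists h, F (k + h) (cell (k + h) x)])
    (theta * M * N ^- k)%:E.
Proof.
move=> m_le.
have /covered_sub := covered_bigcup tree_weight_ge0
  (fun h => covered_first_hit h k c); apply.
  move=> x [Px [xc Fx]].
  have ex : exists h, `[< F (k + h) (cell (k + h) x) >].
    by have [h Fh] := Fx; exists h; apply/asboolP.
  case: (ex_minnP ex) => j /asboolP Fj jmin; exists j => //; split => //; split => // i ij Fi.
  by have /jmin : `[< F (k + i) (cell (k + i) x) >]; [apply/asboolP|rewrite leqNgt ij].
apply: lime_le.
  apply: is_cvg_nneseries => h _ _.
  by rewrite lee_fin !mulr_ge0 ?first_hit_mass_ge0// ltW//.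
apply: nearW => H; rewrite big_mkord sumEFin lee_fin -mulr_suml -mulr_sumr.
apply: ler_wpM2r; first exact: ltW.
by apply: ler_wpM2l => //; exact: m_le.
Qed.

Hypothesis P_often : forall x k0, P x -> exists2 k, (k0 <= k)%N & F k (cell k x).

Lemma covered_infinitely_often k c :
  tcovered (P `&` [set x | cell k x = c]) (theta * N ^- k)%:E.
Proof.
have /covered_sub := covered_stopped (fun H => stopped_mass_le1 H k c); rewrite mulr1; apply => //.
move=> x [Px xc]; split=> //; split=> //; have [j kj Fj] := P_often k Px.
by exists (j - k)%N; rewrite subnKC.
Qed.

(** Points of [P] return to [F] below every cell, so a cover of proportion [theta] can be refined in
    the same way inside each of its own cells; j rounds leave proportion [theta ^+ j]. *)
Lemma null_infinitely_often : theta < 1 -> null tree_set tree_weight P.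
Proof.
move=> theta1.
have iter j k c : tcovered (P `&` [set x | cell k x = c]) (theta ^+ j * N ^- k)%:E.
  elim: j => [|j IH].
    rewrite mul1r; have /covered_sub := covered1 tree_set tree_weight_ge0 (i0 := None) erefl (Some (k, c)).
    by apply => // x [].
  have cell_cov i : tcovered (P `&` tree_set i) (theta%:E * tree_weight i).
    case: i => [[l c']|]/=; first exact: covered_infinitely_often.
    by rewrite setI0 mule0; exact: (@covered0 _ _ _ _ _ None).
  have /covered_sub := covered_trans tree_weight_ge0 tree_weight_ge0 theta_ge0 IH cell_cov.
  apply.
  - by move=> x [Px xc].
  - by rewrite -EFinM mulrA -exprS.
have cvg0 : (fun j => theta ^+ j) @ \oo --> (0 : R).
  by apply: cvg_expr; rewrite ger0_norm.
apply: (@null_sub _ _ _ _ _ (\bigcup_c (P `&` [set x | cell 0 x = c]))); last first.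
  by move=> x Px; exists (cell 0 x).
apply: (@null_bigcup_count _ _ _ _ _ _ None) => // c e e0.
have /cvgr0Pnorm_le/(_ e e0)[j _ je] := cvg0.
have /covered_sub := iter j 0%N c; apply => //.
by rewrite lee_fin expr0 invr1 mulr1 (le_trans (ler_norm _))//; exact: (je j (leqnn j)).
Qed.

End stage.
End stopping.
End tree.

(** * Grids and boxes *)

Section floor.
Variable R : realType.
Implicit Types (x y : R).

Lemma floor_digit (b : nat) y : (0 < b)%N ->
  exists e : 'I_b, Num.floor (b%:R * y) = b%:Z * Num.floor y + (e : nat)%:Z.
Proof.
move=> b0; set z := Num.floor (b%:R * y) - b%:Z * Num.floor y.
have /andP[y1 y2] := floor_itv y; have /andP[z1 z2] := floor_itv (b%:R * y).
have b0' : 0 < b%:R :> R by rewrite ltr0n.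
have zr : z%:~R = (Num.floor (b%:R * y))%:~R - b%:R * (Num.floor y)%:~R :> R.
  by rewrite /z intrB intrM.
rewrite intrD in y2; rewrite intrD in z2.
have z0 : 0 <= z.
  rewrite /z subr_ge0 floor_ge_int intrM.
  by rewrite ler_pM2l.
have zb : z < b%:Z.
  rewrite -(ltr_int R) zr ltrBlDr (le_lt_trans z1)//.
  have : b%:R * y < b%:R * ((Num.floor y)%:~R + 1) by rewrite ltr_pM2l.
  by rewrite mulrDr mulr1 addrC.
have zE : z = `|z|%N%:Z by rewrite gez0_abs.
have zlt : (`|z| < b)%N by rewrite -ltz_nat -zE.
by exists (Ordinal zlt); rewrite /= -zE /z addrC subrK.
Qed.


(* [4 ^ k / 3] lies at distance [1 / 3] from the integers, so the grids of step
   [4 ^- k] through [0] and through [1 / 3] have no two close separators. *)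
Lemma third_shift k (y1 y2 : R) : y1 <= y2 -> 3 * (y2 - y1) <= 4 ^- k ->
  exists b : bool, Num.floor (4 ^+ k * (y1 + b%:R / 3)) =
                   Num.floor (4 ^+ k * (y2 + b%:R / 3)).
Proof.
move=> y12 y21.
have k0 : 0 < 4 ^+ k :> R by rewrite exprn_gt0.
have [q qE] : exists q : nat, 4 ^+ k = 3 * q%:R + 1 :> R.
  exists ((4 ^ k).-1 %/ 3)%N.
  have d3 : (3 %| (4 ^ k).-1)%N.
    by rewrite predn_exp dvdn_mulr.
  have e4 : (4 ^ k = 3 * ((4 ^ k).-1 %/ 3) + 1)%N.
    by rewrite mulnC divnK// addn1 prednK// expn_gt0.
  by rewrite -natrX [in LHS]e4 natrD natrM.
have Y12 : 4 ^+ k * y2 <= 4 ^+ k * y1 + 1 / 3.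
  rewrite -lerBlDl -mulrBr -(ler_pM2l (_ : 0 < 3 :> R))//.
  rewrite mulrCA mulrC -ler_pdivlMr// (le_trans y21)//.
  by rewrite mul1r divff// mul1r.
have Y12' : 4 ^+ k * y1 <= 4 ^+ k * y2 by rewrite ler_pM2l.
set Y1 := 4 ^+ k * y1 in Y12 Y12'; set Y2 := 4 ^+ k * y2 in Y12 Y12'.
have [e|e] := eqVneq (Num.floor Y1) (Num.floor Y2).
  by exists false; rewrite mul0r !addr0.
exists true; set a := Num.floor Y2.
have lt_a : Num.floor Y1 < a.
  by rewrite lt_neqAle e le_floor.
have Ya : Y1 < a%:~R by rewrite -floor_lt_int.
have aY : a%:~R <= Y2 by exact: floor_le.
(* Since 4^k = 3 q + 1, the shift by 1/3 moves scaled coordinates by q + 1/3. The integer [a]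
   separates [Y1] from [Y2], which differ by at most 1/3, so after the shift both lie in [a + q, a +
   q + 1). *)
have fE (Y : R) : a%:~R <= Y + 1 / 3 -> Y + 1 / 3 < a%:~R + 1 ->
    Num.floor (Y + 4 ^+ k / 3) = a + q%:Z.
  move=> h1 h2; apply: floor_def; rewrite qE !intrD.
  have -> : (q%:Z)%:~R = q%:R :> R by [].
  apply/andP; split; lra.
rewrite !mulrDr !mulrA !mulr1 -/Y1 -/Y2 !fE//; lra.
Qed.

Lemma pow4_scale (r : R) : 0 < r -> r <= 1 ->
  exists k : nat, 4 ^- k.+1 < r /\ r <= 4 ^- k.
Proof.
move=> r0 r1.
have ex : exists k : nat, 4 ^- k.+1 < r.
  have /cvgr0Pnorm_lt/(_ r r0)[j _ je] : (fun j => (4^-1 : R) ^+ j) @ \oo --> (0 : R).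
    by apply: cvg_expr; rewrite ger0_norm ?invr_ge0// invf_lt1// ltr1n.
  exists j; have := je j.+1 (leqnSn j); rewrite exprVn => h.
  by rewrite (le_lt_trans (ler_norm _)).
case: (ex_minnP ex) => k kr kmin; exists k; split => //.
case: k kr kmin => [|k] kr kmin; first by rewrite expr0 invr1.
by rewrite leNgt; apply/negP => /kmin; rewrite ltnn.
Qed.

Lemma pow4_le (k l : nat) : (4 ^- k <= 4 ^- l :> R) = (l <= k)%N.
Proof. by rewrite lef_pV2 ?posrE ?exprn_gt0// ler_eXn2l// ltr1n. Qed.

Lemma pow4_small (e : R) : 0 < e -> exists k : nat, 4 ^- k <= e.
Proof.
move=> e0.
have /cvgr0Pnorm_lt/(_ e e0)[j _ je] : (fun j => (4^-1 : R) ^+ j) @ \oo --> (0 : R).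
  by apply: cvg_expr; rewrite ger0_norm ?invr_ge0// invf_lt1// ltr1n.
exists j; have := je j (leqnn j); rewrite exprVn => /ltW h.
exact: le_trans (ler_norm _) h.
Qed.

End floor.

Section box.
Variables (R : realType) (d : nat).
Local Notation V := 'rV[R]_d.

Lemma coord_le_norm (x : V) i : `|x ord0 i| <= `|x|.
Proof.
rewrite [leRHS]/Num.norm /= mx_normrE; apply/bigmax_geP; right => /=.
by exists (ord0, i).
Qed.

Lemma norm_le_coord (x : V) (r : R) : 0 <= r -> (forall i, `|x ord0 i| <= r) -> `|x| <= r.
Proof.
move=> r0 xr; rewrite [leLHS]/Num.norm /= mx_normrE; apply/bigmax_leP; split => //.
by case=> i j _ /=; rewrite (ord1 i).
Qed.

Definition box_set (i : V * V) : set V := box i.1 i.2.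

(* The value [+oo] excludes corners in the wrong order, for which [box_volume] is junk. *)
Definition box_weight (i : V * V) : \bar R :=
  if [forall k, i.1 ord0 k <= i.2 ord0 k] then (box_volume i.1 i.2)%:E else +oo%E.

Lemma box_weight_ge0 i : (0 <= box_weight i)%E.
Proof.
rewrite /box_weight; case: forallP => //= ab; rewrite lee_fin.
by apply: prodr_ge0 => k _; rewrite subr_ge0.
Qed.

Definition box_null := null box_set box_weight.

Lemma lebesgue_outer0_null P : lebesgue_outer P = 0%E -> box_null P.
Proof.
move=> P0 e e0.
have := @lb_ereal_inf_adherent R _ e e0 (_ : lebesgue_outer P \is a fin_num).
rewrite /= -/(lebesgue_outer P) P0 => /(_ isT)[_ [a [b [ab Pab ->]]]].
rewrite add0e => /ltW abe; exists (fun k => (a k, b k)); split => //.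
apply: le_trans abe; apply: lee_nneseries => [k _ _|k _]; first exact: box_weight_ge0.
by rewrite /box_weight /=; case: forallP => // -[].
Qed.

Definition cube (c : V) (s : R) : set V := [set x | `|x - c| <= s].

Hypothesis d_gt0 : (0 < d)%N.

Lemma box_weight0 : box_weight (0, 0) = 0%E.
Proof.
rewrite /box_weight /=; case: forallP => [_|[]//].
rewrite /box_volume (eq_bigr (fun=> 0)) => [|i _]; last by rewrite !mxE subrr.
by rewrite prodr_const card_ord expr0n; case: d d_gt0.
Qed.

Lemma covered_cube c s : 0 <= s ->
  covered box_set box_weight (cube c s) ((2 * s) ^+ d)%:E.
Proof.
move=> s0; pose i : V * V := (c - const_mx s, c + const_mx s).
have := covered1 box_set box_weight_ge0 box_weight0 i; move/covered_sub; apply.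
  move=> x xc k /=; rewrite !mxE.
  have := le_trans (coord_le_norm (x - c) k) xc; rewrite !mxE ler_norml => /andP[h1 h2].
  by apply/andP; split; lra.
rewrite /box_weight; case: forallP => [_|[] k]; last by rewrite /= !mxE; lra.
rewrite lee_fin /box_volume /= (eq_bigr (fun=> 2 * s)) => [|k _].
  by rewrite prodr_const card_ord.
by rewrite !mxE; ring.
Qed.

Lemma box_null_trans (I : Type) (S : I -> set V) (w : I -> \bar R) (C : R) P :
  0 < C -> (forall i, 0 <= w i)%E ->
  (forall i, covered box_set box_weight (S i) (C%:E * w i)%E) ->
  null S w P -> box_null P.
Proof.
move=> C0 w0 Sw P0 e e0.
have Sw' i : covered box_set box_weight (setT `&` S i) (C%:E * w i)%E.
  by rewrite setTI.
have := covered_trans w0 box_weight_ge0 (ltW C0) (P0 (e / C) (divr_gt0 e0 C0)) Sw'.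
by rewrite setTI -EFinM mulrCA divff ?mulr1// gt_eqF.
Qed.

End box.

(** * Porosity *)

Section holes.
Variables (R : realType) (T : Type) (C : countType) (B : finType) (b0 : B).
Variables (cell : nat -> T -> C) (child : nat -> C -> B -> C).
Hypothesis cellS : forall k x, exists b, cell k.+1 x = child k (cell k x) b.
Variable E : set T.

Let N : R := #|B|%:R.
Let N_gt0 : 0 < N.
Proof. by rewrite ltr0n; apply/card_gt0P; exists b0. Qed.

Local Notation tcovered := (covered (tree_set cell) (@tree_weight R C B)).

Fixpoint hole (j k : nat) (c : C) : Prop :=
  if j is j'.+1 then exists b, hole j' k.+1 (child k c b)
  else E `&` [set x | cell k x = c] = set0.

(** The descendant that misses [E] is left out of the cover, which saves the fraction N^-j of the
    weight; each level of the recursion keeps the other children whole. *)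
Lemma covered_hole j k c : hole j k c ->
  tcovered (E `&` [set x | cell k x = c]) ((1 - N ^- j) * N ^- k)%:E.
Proof.
have w0 := @tree_weight_ge0 R C B.
elim: j k c => [|j IH] k c /=.
  move=> ->; rewrite expr0 invr1 subrr mul0r; exact: (@covered0 _ _ _ _ _ None).
move=> [b hb].
pose a b' := if b' == b then ((1 - N ^- j) * N ^- k.+1)%:E else (N ^- k.+1)%:E.
have Nj : N ^- j <= 1.
  by rewrite invf_le1 ?exprn_gt0// exprn_ege1// ler1n; apply/card_gt0P; exists b0.
have a0 b' : (0 <= a b')%E.
  rewrite /a; case: ifP => _; rewrite lee_fin ?mulr_ge0 ?invr_ge0 ?exprn_ge0 ?(ltW N_gt0)//.
  by rewrite subr_ge0.
have ca b' : tcovered (E `&` [set x | cell k.+1 x = child k c b']) (a b').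
  rewrite /a; case: eqP => [->|_]; first exact: IH.
  have := covered1 (tree_set cell) w0 (i0 := None) erefl (Some (k.+1, child k c b')).
  by move/covered_sub; apply => // x [].
have /covered_sub := covered_finite w0 (i0 := None) erefl a0 ca; apply.
  move=> x [Ex xc]; have [b' xb] := cellS k x.
  by exists b' => //; split => //=; rewrite xb xc.
rewrite (bigD1 b)//= {1}/a eqxx.
rewrite (eq_bigr (fun=> (N ^- k.+1)%:E)); last by move=> b' /negPf b'b; rewrite /a b'b.
rewrite sumEFin -EFinD lee_fin sumr_const.
have -> : #|[pred i | i != b]| = #|B|.-1 by rewrite cardC1.
rewrite -mulr_natr.
have -> : (#|B|.-1)%:R = N - 1.
  rewrite /N -subn1 natrB//; by apply/card_gt0P; exists b0.
rewrite !exprS !invfM; set u := N ^- j; set v := N ^- k.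
rewrite le_eqVlt; apply/orP; left; apply/eqP; field.
by rewrite gt_eqF.
Qed.

Lemma hole_descendant j k z :
  E `&` [set x | cell (k + j) x = cell (k + j) z] = set0 -> hole j k (cell k z).
Proof.
elim: j k => [|j IH] k /=; first by rewrite addn0.
rewrite -addSnnS => /IH; have [b ->] := cellS k z; by exists b.
Qed.

Lemma null_often_hole j :
  null (tree_set cell) (@tree_weight R C B)
    [set x | E x /\ forall k0, exists2 k, (k0 <= k)%N & hole j k (cell k x)].
Proof.
apply: (null_infinitely_often b0 (child := child) cellS (F := hole j)
  (theta := 1 - N ^- j)).
- rewrite subr_ge0 invf_le1 ?exprn_gt0// exprn_ege1// ler1n; by apply/card_gt0P; exists b0.
- move=> k c h; have /covered_sub := covered_hole h; apply => //.
  by move=> x [[Ex _] xc].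
- by move=> x k0 [Ex /(_ k0)].
- by rewrite gtrBl invr_gt0 exprn_gt0.
Qed.

End holes.

Section porosity.
Variables (R : realType) (d : nat).
Local Notation V := 'rV[R]_d.

(** This stands in for a Lebesgue density point: it makes sense for arbitrary [E] and supplies
    exactly what is used later, points of [E] near prescribed places. *)
Definition nonporous (E : set V) (x : V) := forall e : R, 0 < e ->
  exists2 r0 : R, 0 < r0 & forall r z, 0 < r -> r < r0 -> `|z - x| <= r ->
    exists2 y, E y & `|y - z| <= e * r.

(** Each coordinate is shifted by 0 or by 1/3, giving 2^d grids. By [third_shift], two points at
    distance at most a third of the step share a cell in one of these grids. *)
Definition shift_cell (t : {ffun 'I_d -> bool}) (k : nat) (x : V) : {ffun 'I_d -> int} :=
  [ffun i => Num.floor (4 ^+ k * (x ord0 i + (t i)%:R / 3))].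

Definition cube_child (k : nat) (c : {ffun 'I_d -> int}) (b : {ffun 'I_d -> 'I_4}) :
    {ffun 'I_d -> int} := [ffun i => 4 * c i + (b i : nat)%:Z].

Lemma shift_cellS t k x :
  exists b, shift_cell t k.+1 x = cube_child k (shift_cell t k x) b.
Proof.
have h i := floor_digit (4 ^+ k * (x ord0 i + (t i)%:R / 3)) (b := 4) isT.
have /choice[b bE] := h.
by exists [ffun i => b i]; apply/ffunP => i; rewrite !ffunE exprS -mulrA bE.
Qed.

Lemma shift_cell_near t k x y : shift_cell t k x = shift_cell t k y ->
  `|x - y| <= 4 ^- k.
Proof.
have k0 : 0 < 4 ^+ k :> R by rewrite exprn_gt0.
move=> /ffunP xy; apply: norm_le_coord; first by rewrite invr_ge0 ltW.
move=> i; have := xy i; rewrite !ffunE !mxE.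
set X := 4 ^+ k * _; set Y := 4 ^+ k * _ => XY.
have /andP[x1 x2] := floor_itv X; have /andP[y1 y2] := floor_itv Y.
rewrite XY in x1 x2; rewrite intrD in x2 y2.
have -> : x ord0 i - y ord0 i = (X - Y) * 4 ^- k.
  by rewrite /X /Y; field; rewrite gt_eqF.
rewrite normrM (ger0_norm (_ : 0 <= 4 ^- k)) ?invr_ge0 ?(ltW k0)//.
rewrite ler_piMl ?invr_ge0 ?(ltW k0)// ler_norml; apply/andP; split; lra.
Qed.

Hypothesis d_gt0 : (0 < d)%N.

(** A nonempty cell of level k lies in the cube of side 2 * 4^-k around any of its points, and its
    weight is 4^-(d k); hence the factor 2^d. *)
Lemma shift_cell_null t P : null (tree_set (shift_cell t))
  (@tree_weight R _ {ffun 'I_d -> 'I_4}) P -> box_null P.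
Proof.
apply: (@box_null_trans R d _ _ _ (2 ^+ d)) => //.
  exact: tree_weight_ge0.
have c0 : covered (@box_set R d) (@box_weight R d) set0 0%E.
  exact: (covered0 _ (box_weight0 R d_gt0)).
case=> [[k c]|]/=; last by rewrite mule0.
have [[y yc]|nc] := pselect (exists y, shift_cell t k y = c); last first.
  have /covered_sub := c0; apply.
    by move=> x xc; apply: nc; exists x.
  by rewrite -EFinM lee_fin mulr_ge0 ?exprn_ge0// invr_ge0 exprn_ge0.
have k0 : 0 <= 4 ^- k :> R by rewrite invr_ge0 exprn_ge0.
have /covered_sub := covered_cube d_gt0 y k0; apply.
  by move=> x /= xc; apply: (@shift_cell_near t); rewrite xc.
rewrite -EFinM lee_fin card_ffun !card_ord exprMn ler_wpM2l ?exprn_ge0//.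
by rewrite natrX exprVn -!exprM mulnC.
Qed.

(** If [E] has no point within [e * r] of [z], a small enough cell around [z] misses [E]. In a grid
    where [x] and [z] share a cell of size comparable to [r], this is a hole at bounded depth below
    the cell of [x]; holes of one depth recur at arbitrarily small scales only on a null part of
    [E]. *)
Lemma nonporous_null (E : set V) : box_null [set x | E x /\ ~ nonporous E x].
Proof.
pose bad (tj : {ffun 'I_d -> bool} * nat) := [set x : V | E x /\ forall k0, exists2 k,
  (k0 <= k)%N & hole (shift_cell tj.1) cube_child E tj.2 k (shift_cell tj.1 k x)].
apply: (@null_sub _ _ _ _ _ (\bigcup_tj bad tj)).
  apply: (null_bigcup_count (box_weight_ge0 (d := d)) (box_weight0 R d_gt0)) => -[t j].
  apply: (@shift_cell_null t).
  exact: (null_often_hole [ffun=> ord0] (@shift_cellS t) E j).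
move=> x [Ex nx]; apply: contrapT => xbad; apply: nx => e e0.
(* The level k chosen below satisfies 4^-k < 12 r, so cells j levels further down have size at most
   [e * r]. *)
have e120 : 0 < e / 12 by rewrite divr_gt0.
have [j je] := pow4_small e120.
have /choice[K KP] : forall t : {ffun 'I_d -> bool}, exists k0 : nat, forall k, (k0 <= k)%N ->
    ~ hole (shift_cell t) cube_child E j k (shift_cell t k x).
  move=> t; apply: contrapT => h; apply: xbad; exists (t, j) => //; split => // k0.
  apply: contrapT => h'; apply: h; exists k0 => k kk hk; apply: h'; by exists k.
(* One threshold for all shifts, because the shift is chosen only after [z]. *)
pose K0 := (\max_t K t)%N.
exists (4 ^- K0 / 3); first by rewrite divr_gt0// invr_gt0 exprn_gt0.
move=> r z r0 rK zx.
have r3 : 0 < 3 * r by rewrite mulr_gt0.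
have rK3 : 3 * r < 4 ^- K0 by rewrite mulrC -ltr_pdivlMr.
have r31 : 3 * r <= 1.
  by rewrite (le_trans (ltW rK3))// -[leRHS]invr1 -[X in _ <= X^-1](expr0 4) pow4_le.
have [k [kr rk]] := pow4_scale r3 r31.
have Kk : (K0 <= k)%N.
  by have := lt_trans kr rK3; rewrite ltNge pow4_le -ltnNge ltnS.
have /choice[t tE] : forall i, exists b : bool,
    Num.floor (4 ^+ k * (x ord0 i + b%:R / 3)) = Num.floor (4 ^+ k * (z ord0 i + b%:R / 3)).
  move=> i; have := le_trans (coord_le_norm (z - x) i) zx; rewrite !mxE => zxi.
  have h3 (u v : R) : u <= v -> v - u <= r -> 3 * (v - u) <= 4 ^- k.
    by move=> uv vu; apply: le_trans rk; rewrite ler_pM2l.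
  have /orP[xz|zx'] := le_total (x ord0 i) (z ord0 i).
    by apply: third_shift => //; apply: h3 => //; apply: le_trans zxi; exact: ler_norm.
  have [|b bE] := @third_shift R k _ _ zx'; last by exists b; rewrite bE.
  by apply: h3 => //; apply: le_trans zxi; rewrite distrC ler_norm.
pose t' := [ffun i => t i].
have tz : shift_cell t' k x = shift_cell t' k z.
  by apply/ffunP => i; rewrite !ffunE tE.
have Ktk : (K t' <= k)%N by apply: leq_trans Kk; exact: (leq_bigmax t').
apply: contrapT => nE; apply: (KP t' k Ktk); rewrite tz.
apply: hole_descendant; first exact: shift_cellS.
rewrite -subset0 => y [Ey yz]; apply: nE; exists y => //.
apply: le_trans (shift_cell_near yz) _.
rewrite exprD invfM.
have : 4 ^- k < 12 * r.
  by move: kr; rewrite exprS invfM ltr_pdivrMl// mulrA -natrM.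
move=> /ltW k12.
apply: (@le_trans _ _ ((12 * r) * (e / 12))).
  by apply: ler_pM => //; rewrite invr_ge0 exprn_ge0.
by rewrite le_eqVlt; apply/orP; left; apply/eqP; field.
Qed.

End porosity.

(** * Directional difference quotients of a pseudometric *)

Section pseudometric.
Variables (R : realType) (d : nat).
Local Notation V := 'rV[R]_d.

Record lip_pseudometric (L : R) (D : V -> V -> R) : Prop := LipPseudometric {
  pm_const : 0 <= L;
  pm_refl : forall x, D x x = 0;
  pm_sym : forall x y, D x y = D y x;
  pm_triangle : forall y x z, D x z <= D x y + D y z;
  pm_lip : forall x y, D x y <= L * `|x - y| }.

Variables (L : R) (D : V -> V -> R).
Hypothesis HD : lip_pseudometric L D.

Lemma pm_ge0 x y : 0 <= D x y.
Proof.
have := pm_triangle HD y x x; rewrite (pm_refl HD) (pm_sym HD y x); lra.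
Qed.

Lemma pm_near (r : R) x y : `|x - y| <= r -> D x y <= L * r.
Proof.
by move=> xy; apply: le_trans (pm_lip HD x y) _; rewrite ler_wpM2l// (pm_const HD).
Qed.

Lemma pm_perturb (r s : R) x y x' y' : `|x - x'| <= r -> `|y - y'| <= s ->
  D x y <= D x' y' + L * (r + s).
Proof.
move=> xx yy; have h1 := pm_near xx; have h2 := pm_near yy.
have := pm_triangle HD x' x y; have := pm_triangle HD y' x' y.
rewrite (pm_sym HD y' y); rewrite mulrDr; lra.
Qed.

Lemma pm_chain (v y : V) (h : R) n : D y (y + (n%:R * h) *: v) <=
  \sum_(i < n) D (y + (i%:R * h) *: v) (y + (i.+1%:R * h) *: v).
Proof.
elim: n => [|n IH]; first by rewrite mul0r scale0r addr0 (pm_refl HD) big_ord0.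
rewrite big_ord_recr /=.
apply: le_trans (pm_triangle HD (y + (n%:R * h) *: v) _ _) _.
by rewrite lerD2r; exact: IH.
Qed.

End pseudometric.

(** * Cells elongated along a direction *)

Section skew_cells.
Variables (R : realType) (d : nat) (v : 'rV[R]_d) (j : 'I_d) (t : R).
Local Notation V := 'rV[R]_d.
Hypothesis vj : v ord0 j != 0.

(** [along] and [across] are the coordinates of [x] in the basis made of [v] and the standard
    vectors other than the j-th; [skew_pt] is the inverse map. *)
Definition along (x : V) : R := x ord0 j / v ord0 j.
Definition across (x : V) (i : 'I_d.-1) : R :=
  x ord0 (lift j i) - along x * v ord0 (lift j i).

Definition skew_pt (s : R) (u : 'I_d.-1 -> R) : V :=
  \row_i (s * v ord0 i + oapp u 0 (unlift j i)).

Lemma skew_ptD s s' u : skew_pt (s + s') u = skew_pt s u + s' *: v.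
Proof. by apply/rowP => i; rewrite !mxE; ring. Qed.

Lemma skew_pt_near s u u' r : 0 <= r -> (forall i, `|u i - u' i| <= r) ->
  `|skew_pt s u - skew_pt s u'| <= r.
Proof.
move=> r0 uu; apply: norm_le_coord => // i; rewrite !mxE.
case: (unlift j i) => [i'|] /=; last by rewrite addr0 subrr normr0.
by rewrite [X in `|X|](_ : _ = u i' - u' i')//; ring.
Qed.

Lemma skew_ptK x : skew_pt (along x) (across x) = x.
Proof.
apply/rowP => i; rewrite !mxE; case: unliftP => [i' ->|->] /=.
  by rewrite /across; ring.
by rewrite addr0 /along divfK.
Qed.

(* Cells have size [4 ^- k] along [v] but only [16 ^- k] across: moving a crossing
   segment inside a cell then costs a relative error [4 ^- k], which is summable. *)
Definition skew_cell (k : nat) (x : V) : (int * {ffun 'I_d.-1 -> int})%type :=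
  (Num.floor (4 ^+ k * (along x + t)), [ffun i => Num.floor (16 ^+ k * across x i)]).

Definition skew_child (k : nat) (c : (int * {ffun 'I_d.-1 -> int})%type)
    (b : ('I_4 * {ffun 'I_d.-1 -> 'I_16})%type) : (int * {ffun 'I_d.-1 -> int})%type :=
  (4 * c.1 + (b.1 : nat)%:Z, [ffun i => 16 * c.2 i + (b.2 i : nat)%:Z]).

Lemma skew_cellS k x : exists b, skew_cell k.+1 x = skew_child k (skew_cell k x) b.
Proof.
have [b0 b0E] := floor_digit (4 ^+ k * (along x + t)) (b := 4) isT.
have /choice[b bE] := fun i => floor_digit (16 ^+ k * across x i) (b := 16) isT.
exists (b0, [ffun i => b i]); rewrite /skew_cell /skew_child /=; congr pair.
  by rewrite exprS -mulrA b0E.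
by apply/ffunP => i; rewrite !ffunE exprS -mulrA bE.
Qed.

Definition corner (k : nat) (c : (int * {ffun 'I_d.-1 -> int})%type) : V :=
  skew_pt (c.1%:~R * 4 ^- k - t) (fun i => (c.2 i)%:~R * 16 ^- k).

Lemma floor_mul (y b : R) : 0 < b ->
  0 <= y - (Num.floor (b * y))%:~R * b^-1 < b^-1.
Proof.
move=> b0; have /andP[y1 y2] := floor_itv (b * y); rewrite intrD in y2.
rewrite subr_ge0 ler_pdivrMr// (mulrC y) y1 /= ltrBlDr.
by rewrite -[X in X + _]mul1r -mulrDl ltr_pdivlMr// (mulrC y) addrC.
Qed.

(** The offset [th] in the long direction is kept exactly; only the transverse offset, of size at
    most 16^-k, is discarded. *)
Lemma corner_near k x : exists th : R,
  [/\ 0 <= th, th < 4 ^- k, th = along x + t - (skew_cell k x).1%:~R * 4 ^- k &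
   `|x - (corner k (skew_cell k x) + th *: v)| <= 16 ^- k].
Proof.
have /andP[th0 th1] : 0 <= along x + t - (skew_cell k x).1%:~R * 4 ^- k < 4 ^- k.
  by apply: floor_mul; rewrite exprn_gt0.
eexists; split; [exact: th0|exact: th1|by []|].
rewrite /corner -skew_ptD -{1}(skew_ptK x).
rewrite (_ : _ - t + _ = along x); last by ring.
apply: skew_pt_near => [|i]; first by rewrite invr_ge0 exprn_ge0.
rewrite /skew_cell /= ffunE.
have b0 : 0 < 16 ^+ k :> R by rewrite exprn_gt0.
have /andP[u0 u1] := floor_mul (across x i) b0.
by rewrite ger0_norm// ltW.
Qed.

(** Whatever its transverse digits, a child has its corner within 16^-k of the start of the quarter
    of the crossing segment singled out by [b.1]. *)
Lemma corner_child k c (b : ('I_4 * {ffun 'I_d.-1 -> 'I_16})%type) :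
  `|corner k c + ((b.1 : nat)%:R * 4 ^- k.+1) *: v - corner k.+1 (skew_child k c b)|
    <= 16 ^- k.
Proof.
rewrite /corner -skew_ptD /=.
rewrite [X in skew_pt X _ - _](_ : _ = (4 * c.1 + (b.1 : nat)%:Z)%:~R * 4 ^- k.+1 - t); last first.
  by rewrite intrD intrM exprS invfM; field; rewrite expf_neq0.
have k0 : 0 < 16 ^- k :> R by rewrite invr_gt0 exprn_gt0.
apply: skew_pt_near => [|i]; first exact: ltW.
rewrite ffunE intrD intrM exprS invfM.
rewrite [X in `|X|](_ : _ = - ((b.2 i : nat)%:R / 16 * 16 ^- k)); last first.
  by rewrite /=; field; rewrite expf_neq0.
rewrite normrN ger0_norm; last by rewrite !mulr_ge0// ltW.
rewrite ler_piMl ?ltW// ltr_pdivrMr// mul1r ltr_nat; exact: ltn_ord.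
Qed.

Lemma pow16E (k : nat) : 16 ^+ k = 4 ^+ k * 4 ^+ k :> R.
Proof. by rewrite -exprMn -natrM. Qed.

(** An elongated cell of level k is covered by 4^k cubes of radius (1 + |v|) * 16^-k centred on its
    crossing segment. Their total volume is a constant times 4^k * 16^-(d k), and 4^k * 16^-(d k) is
    the weight of the cell. *)
Lemma skew_null P : null (tree_set skew_cell)
  (@tree_weight R _ ('I_4 * {ffun 'I_d.-1 -> 'I_16})%type) P -> box_null P.
Proof.
have d_gt0 : (0 < d)%N by apply: leq_ltn_trans (ltn_ord j).
pose W : R := 1 + `|v|.
have W0 : 0 < W by rewrite ltr_pwDl.
apply: (@box_null_trans R d _ _ _ ((2 * W) ^+ d)).
- by rewrite exprn_gt0// mulr_gt0.
- exact: tree_weight_ge0.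
have c0 : covered (@box_set R d) (@box_weight R d) set0 0%E.
  exact: (covered0 _ (box_weight0 R d_gt0)).
case=> [[k c]|]/=; last by rewrite mule0.
have [[y yc]|nc] := pselect (exists y, skew_cell k y = c); last first.
  have /covered_sub := c0; apply.
    by move=> x xc; apply: nc; exists x.
  by rewrite -EFinM lee_fin mulr_ge0 ?exprn_ge0 ?invr_ge0 ?exprn_ge0// mulr_ge0// ltW.
have k0 : 0 < 16 ^- k :> R by rewrite invr_gt0 exprn_gt0.
have r0 : 0 <= W * 16 ^- k by rewrite mulr_ge0// ltW.
have a0 (i : 'I_(4 ^ k)) : (0 <= ((2 * (W * 16 ^- k)) ^+ d)%:E)%E.
  by rewrite lee_fin exprn_ge0// mulr_ge0.
have cc (i : 'I_(4 ^ k)) := covered_cube d_gt0 (corner k c + (i%:R * 16 ^- k) *: v) r0.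
have /covered_sub := covered_finite (@box_weight_ge0 R d) (box_weight0 R d_gt0) a0 cc.
apply.
  move=> x xc; have [th [th0 th1 _ xth]] := corner_near k x.
  rewrite xc in xth.
  pose i := `|Num.floor (16 ^+ k * th)|%N.
  have fl0 : 0 <= Num.floor (16 ^+ k * th) by rewrite floor_ge0 mulr_ge0 ?exprn_ge0.
  have iE : i%:R = (Num.floor (16 ^+ k * th))%:~R :> R.
    by rewrite -[in RHS](gez0_abs fl0).
  have i4 : (i < 4 ^ k)%N.
    rewrite -(ltr_nat R) iE (le_lt_trans (floor_le _))// natrX.
    rewrite -ltr_pdivlMl ?exprn_gt0// (lt_le_trans th1)//.
    by rewrite pow16E invfM -mulrA mulVf ?mulr1// expf_neq0.
  exists (Ordinal i4) => //; rewrite /cube /= iE.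
  set f := (Num.floor _)%:~R.
  have /andP[f0 f1] : 0 <= th - f * 16 ^- k < 16 ^- k.
    by apply: floor_mul; rewrite exprn_gt0.
  rewrite [X in `|X|](_ : _ = (x - (corner k c + th *: v)) + (th - f * 16 ^- k) *: v).
    apply: le_trans (ler_normD _ _) _; rewrite mulrDl mul1r lerD//.
    by rewrite normrZ mulrC ler_wpM2l// ger0_norm// ltW.
  by apply/rowP => l; rewrite !mxE; ring.
rewrite -EFinM sumEFin lee_fin sumr_const card_ord -[leLHS]mulr_natl natrX.
rewrite [2 * (_ * _)]mulrA exprMn mulrCA.
apply: ler_wpM2l; first by rewrite exprn_ge0// mulr_ge0// ltW.
rewrite card_prod card_ffun !card_ord natrM natrX exprMn.
have -> : d = d.-1.+1 by rewrite prednK.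
rewrite [X in _ * X](_ : _ = 16 ^- k * (16 ^+ d.-1) ^- k); last first.
  by rewrite exprS -!exprVn exprAC.
rewrite mulrA [X in X * _ <= _](_ : _ = 4 ^- k); last first.
  by rewrite pow16E invfM mulrA divff ?mul1r// expf_neq0.
by rewrite /= invfM.
Qed.

End skew_cells.

Section slopes.
Variables (R : realType) (d : nat) (L : R) (D : 'rV[R]_d -> 'rV[R]_d -> R).
Hypothesis HD : lip_pseudometric L D.
Variables (v : 'rV[R]_d) (j : 'I_d) (t : R).
Hypothesis vj : v ord0 j != 0.

Local Notation corner := (corner v j t).
Local Notation cell := (skew_cell v j t).
Local Notation B := ('I_4 * {ffun 'I_d.-1 -> 'I_16})%type.
Local Notation tcell := (int * {ffun 'I_d.-1 -> int})%type.

Definition slope (k : nat) (c : tcell) : R :=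
  4 ^+ k * D (corner k c) (corner k c + 4 ^- k *: v).

(** By [slope_split] a slope exceeds the mean over the children by at most 8 L 4^-k. The correction
    drops by 9 L 4^-k from level k to level k + 1, which absorbs this error and leaves an exact
    submartingale. *)
Definition corrected_slope (k : nat) (c : tcell) : R := slope k c - 12 * L * 4 ^- k.

Lemma slope_ge0 k c : 0 <= slope k c.
Proof. by rewrite mulr_ge0 ?exprn_ge0 ?(pm_ge0 HD). Qed.

Lemma slope_le k c : slope k c <= L * `|v|.
Proof.
rewrite /slope -ler_pdivlMl ?exprn_gt0// mulrCA; apply: (pm_near HD).
by rewrite opprD addrA subrr add0r normrN normrZ ger0_norm// invr_ge0 exprn_ge0.
Qed.

(** Triangle inequality over the four quarters of the crossing segment. Moving one quarter to the
    corner of its child costs 2 L 16^-k; the four together, rescaled by 4^k, cost 8 L 4^-k. The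
    transverse digit [b] is arbitrary, so the estimate can be averaged over it. *)
Lemma slope_split k c (b : {ffun 'I_d.-1 -> 'I_16}) :
  slope k c <= 4^-1 * \sum_(a < 4) slope k.+1 (skew_child k c (a, b)) + 8 * L * 4 ^- k.
Proof.
have k0 : 0 < 4 ^+ k :> R by rewrite exprn_gt0.
have L0 := pm_const HD.
pose h : R := 4 ^- k.+1.
have kh : 4 ^- k = 4%:R * h :> R.
  by rewrite /h exprS invfM mulrA divff ?mul1r// pnatr_eq0.
have := pm_chain HD v (corner k c) h 4; rewrite -kh => chain.
have step (a : 'I_4) : D (corner k c + (a%:R * h) *: v) (corner k c + (a.+1%:R * h) *: v)
    <= h * slope k.+1 (skew_child k c (a, b)) + L * (16 ^- k + 16 ^- k).
  have near := corner_child v j t k c (a, b); rewrite /= -/h in near.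
  rewrite /slope mulrA mulVf ?mul1r ?expf_neq0// -/h.
  apply: (pm_perturb HD) => //.
  rewrite -[X in (X%:R * h)]addn1 natrD mulrDl mul1r scalerDl addrA.
  by rewrite [X in `|X|](_ : _ = corner k c + (a%:R * h) *: v -
    corner k.+1 (skew_child k c (a, b)))//; apply/rowP => i; rewrite !mxE; ring.
have : D (corner k c) (corner k c + 4 ^- k *: v) <=
    h * (\sum_(a < 4) slope k.+1 (skew_child k c (a, b))) + 8 * L * 16 ^- k.
  apply: le_trans chain _; apply: le_trans (ler_sum _ (fun a _ => step a)) _.
  rewrite big_split /= -mulr_sumr sumr_const card_ord lerD2l -[leLHS]mulr_natl.
  by rewrite le_eqVlt; apply/orP; left; apply/eqP; set u := 16 ^- k; ring.
move=> hD; rewrite /slope -ler_pdivlMl//; apply: le_trans hD _.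
rewrite mulrDr lerD//.
  by rewrite mulrA -invfM -exprSr.
rewrite pow16E invfM; move: k0; move: (4 ^+ k) => u u0.
by rewrite le_eqVlt; apply/orP; left; apply/eqP; field; rewrite gt_eqF.
Qed.

Lemma corrected_slope_submartingale k c :
  corrected_slope k c <= (#|{: B}|%:R)^-1 *
    \sum_(b : B) corrected_slope k.+1 (skew_child k c b).
Proof.
have L0 := pm_const HD.
pose M := #|{: {ffun 'I_d.-1 -> 'I_16}}|.
have M0 : (0 < M)%N by apply/card_gt0P; exists [ffun=> ord0].
have cB : #|{: B}| = (4 * M)%N by rewrite card_prod card_ord.
have M0' : 0 < M%:R :> R by rewrite ltr0n.
rewrite cB ler_pdivlMl; last by rewrite ltr0n muln_gt0.
rewrite /corrected_slope sumrB sumr_const cB.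
have -> : \sum_(b : B) slope k.+1 (skew_child k c b) =
    \sum_(b : {ffun 'I_d.-1 -> 'I_16}) \sum_(a < 4) slope k.+1 (skew_child k c (a, b)).
  by rewrite exchange_big /= pair_big /=; apply: eq_bigr => -[a b].
have hsum : (4 * M)%:R * slope k c <=
    \sum_(b : {ffun 'I_d.-1 -> 'I_16}) \sum_(a < 4) slope k.+1 (skew_child k c (a, b))
    + (4 * M)%:R * (8 * L * 4 ^- k).
  have -> : (4 * M)%:R * slope k c = \sum_(b : {ffun 'I_d.-1 -> 'I_16}) 4 * slope k c.
    by rewrite sumr_const -[RHS]mulr_natl -/M mulrA -natrM mulnC.
  have -> : (4 * M)%:R * (8 * L * 4 ^- k) =
      \sum_(b : {ffun 'I_d.-1 -> 'I_16}) 4 * (8 * L * 4 ^- k).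
    by rewrite sumr_const -[RHS]mulr_natl -/M [RHS]mulrA -natrM mulnC.
  rewrite -big_split /=; apply: ler_sum => b _.
  rewrite -ler_pdivlMl// mulrDr (mulrA _ 4) mulVf// mul1r.
  exact: slope_split.
have : (4 * M)%:R * (8 * L * 4 ^- k) + (12 * L * 4 ^- k.+1) *+ (4 * M) <=
    (4 * M)%:R * (12 * L * 4 ^- k).
  rewrite -[X in _ + X]mulr_natl -mulrDr ler_wpM2l// exprS invfM.
  have : 0 <= L * 4 ^- k by rewrite mulr_ge0// invr_ge0 exprn_ge0.
  by move: (4 ^- k) => u; lra.
move=> err; rewrite mulrBr lerBlDr; apply: le_trans hsum _.
by rewrite -addrA lerD2l addrC lerBrDr.
Qed.

(** In a cell with corrected slope above q', optional stopping shows that descendants with slope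
    below q fill at most the proportion (M - q') / (M - q) < 1. A point that oscillates forever
    passes through such cells infinitely often. *)
Lemma null_upcrossing (q q' : R) : q < q' ->
  null (tree_set cell) (@tree_weight R _ B)
   [set x | (forall k0, exists2 k, (k0 <= k)%N & q' < corrected_slope k (cell k x)) /\
            (forall k0, exists2 k, (k0 <= k)%N & corrected_slope k (cell k x) < q)].
Proof.
move=> qq.
pose M := Num.max (L * `|v|) (q' + 1).
have M1 : L * `|v| <= M by rewrite le_max lexx.
have M2 : q' < M by rewrite lt_max (ltrDl q') ltr01 orbT.
have Mq : 0 < M - q by rewrite subr_gt0 (lt_trans qq).
have gM k c : corrected_slope k c <= M.
  apply: le_trans M1; rewrite (le_trans _ (slope_le k c))// gerBl.
  by rewrite !mulr_ge0 ?(pm_const HD)// invr_ge0 exprn_ge0.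
pose theta := (M - q') / (M - q).
have b0 : B := (ord0, [ffun=> ord0]).
apply: (@null_infinitely_often R _ _ _ b0 _ _ (skew_cellS v j t)
  (fun k c => q' < corrected_slope k c) _ theta).
- by rewrite divr_ge0 ?(ltW Mq)// subr_ge0 ltW.
- move=> k c qc.
  have F1 l e : corrected_slope l e < q -> covered (tree_set cell) (@tree_weight R _ B)
     (setT `&` [set x | cell l x = e]) (1 * (#|{: B}|%:R) ^- l)%:E.
    move=> _; rewrite setTI mul1r.
    exact: (covered1 (tree_set cell) (@tree_weight_ge0 R _ B) (i0 := None) erefl (Some (l, e))).
  have mass_le H : stopped_mass R (@skew_child d)
      (fun k c => corrected_slope k c < q) H k c <= theta.
    have := stopped_submartingale b0 gM
      (fun k c (h : corrected_slope k c < q) => ltW h) corrected_slope_submartingale H k c.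
    move: (stopped_mass _ _ _ _ _) => s hs; rewrite ler_pdivlMr//.
    move: hs qc; move: (corrected_slope k c) => z; lra.
  have := @covered_stopped R _ _ _ b0 _ _ (skew_cellS v j t)
    (fun k c => corrected_slope k c < q) setT 1 ler01 F1 theta k c mass_le.
  rewrite mul1r setTI => /covered_sub; apply => //.
  move=> x [[_ xq] xc]; split => //; have [l kl lq] := xq k.
  by exists (l - k)%N; rewrite subnKC.
- by move=> x k0 [h _]; exact: h.
- by rewrite ltr_pdivrMr// mul1r ltrD2l ltrN2.
Qed.

(* On the complement of the upcrossing sets the corrected slopes converge, so
   they end up in one interval of any subdivision. *)
Lemma slope_stabilises (eta : R) : 0 < eta ->
  box_null (~` [set x | exists n k0 : nat, forall k, (k0 <= k)%N ->
    `|slope k (cell k x) - (n%:R * eta - 12 * L - 1)| <= 2 * eta]).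
Proof.
move=> eta0; have L0 := pm_const HD.
(* Level 0 lies strictly below every corrected slope: slopes are nonnegative and the correction is
   at most 12 L. *)
pose lev (n : nat) : R := n%:R * eta - 12 * L - 1.
pose bad n := [set x | (forall k0, exists2 k, (k0 <= k)%N & lev n.+1 < corrected_slope k (cell k x)) /\
            (forall k0, exists2 k, (k0 <= k)%N & corrected_slope k (cell k x) < lev n)].
apply: (skew_null vj (t := t)).
apply: (@null_sub _ _ _ _ _ (\bigcup_n bad n)).
  apply: null_bigcup; first exact: tree_weight_ge0.
  by move=> n; apply: null_upcrossing; rewrite /lev -natr1; lra.
move=> x; apply: contra_notP => xbad.
have nbad n : ~ bad n x by move=> h; apply: xbad; exists n.
pose g k := corrected_slope k (cell k x).
pose P n := `[< forall k0, exists2 k, (k0 <= k)%N & lev n < g k >].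
have k_le1 k : 4 ^- k <= 1 :> R by rewrite -[leRHS]invr1 -[X in _ <= X^-1](expr0 4) pow4_le.
have g_lower k : lev 0 < g k.
  rewrite /lev /g /corrected_slope mul0r.
  have := slope_ge0 k (cell k x).
  have : 12 * L * 4 ^- k <= 12 * L by rewrite ler_piMr// mulr_ge0.
  move: (12 * L * 4 ^- k) (slope _ _) => y z; lra.
have exP : exists n, P n by exists 0%N; apply/asboolP => k0; exists k0.
have upP n : P n -> (n <= Num.truncn ((L * `|v| + 12 * L + 1) / eta))%N.
  move=> /asboolP/(_ 0%N)[k _ gk].
  rewrite truncn_ge_nat; last first.
    by rewrite divr_ge0 ?(ltW eta0)// !addr_ge0// mulr_ge0.
  rewrite ler_pdivlMr//.
  have : g k <= L * `|v|.
    rewrite (le_trans _ (slope_le k (cell k x)))// gerBl.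
    by rewrite !mulr_ge0 ?(pm_const HD)// invr_ge0 exprn_ge0.
  move: gk; rewrite /lev; move: (g k) (L * `|v|) (n%:R * eta) => a b c; lra.
(* With n the largest level exceeded infinitely often, the corrected slopes end up below level n +
   1. Falling infinitely often below level n - 1 would be an upcrossing, so they also end up above
   it. *)
case: (ex_maxnP exP upP) => n /asboolP Pn nmax.
have upper : exists k0, forall k, (k0 <= k)%N -> g k <= lev n.+1.
  apply: contrapT => h; suff : P n.+1 by move/nmax; rewrite ltnn.
  apply/asboolP => k0; apply: contrapT => h'; apply: h; exists k0 => k kk.
  by rewrite leNgt; apply/negP => gk; apply: h'; exists k.
have lower : exists k0, forall k, (k0 <= k)%N -> lev n - eta <= g k.
  case: n {nmax upper} Pn => [|n] Pn.
    exists 0%N => k _; apply: le_trans (ltW (g_lower k)).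
    by rewrite gerBl ltW.
  have -> : lev n.+1 - eta = lev n by rewrite /lev -natr1; ring.
  apply: contrapT => h; apply: (nbad n); split => // k0.
  apply: contrapT => h'; apply: h; exists k0 => k kk.
  by rewrite leNgt; apply/negP => gk; apply: h'; exists k.
have [k1 kP1] := upper; have [k2 kP2] := lower.
have [k3 kP3] : exists k3 : nat, 12 * L * 4 ^- k3 <= eta.
  have L12 : 0 < 12 * L + 1 by rewrite ltr_wpDl// mulr_ge0.
  have [k3 h] := pow4_small (divr_gt0 eta0 L12).
  exists k3; rewrite ler_pdivlMr// mulrC in h; apply: le_trans h.
  by rewrite ler_wpM2r ?lerDl// invr_ge0 exprn_ge0.
exists n, (maxn k1 (maxn k2 k3)) => k; rewrite !geq_max => /and3P[h1 h2 h3].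
have := kP1 k h1; have := kP2 k h2.
have : 12 * L * 4 ^- k <= eta.
  by apply: le_trans kP3; rewrite ler_wpM2l ?mulr_ge0// pow4_le.
have : 0 <= 12 * L * 4 ^- k by rewrite !mulr_ge0// invr_ge0 exprn_ge0.
rewrite /g /corrected_slope -/(lev n) (_ : lev n.+1 = lev n + eta); last first.
  by rewrite /lev -natr1; ring.
move: (12 * L * 4 ^- k) (slope _ _) (lev n) => a b c h4 h5 h6 h7.
by rewrite ler_norml; apply/andP; split; lra.
Qed.

End slopes.

(** * From crossing segments to all short segments near a point *)

Section directional.
Variables (R : realType) (d : nat) (L : R) (D : 'rV[R]_d -> 'rV[R]_d -> R).
Hypothesis HD : lip_pseudometric L D.
Variables (v : 'rV[R]_d) (j : 'I_d).
Hypothesis vj : v ord0 j != 0.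
Local Notation V := 'rV[R]_d.

Local Notation along := (along v j).

Lemma alongD x s : along (x + s *: v) = along x + s.
Proof. by rewrite /along !mxE mulrDl mulfK. Qed.

Lemma along_near x y (r : R) : `|x - y| <= r -> `|along x - along y| <= r / `|v ord0 j|.
Proof.
move=> xy; rewrite /along -mulrBl normrM normfV ler_wpM2r ?invr_ge0//.
by have := le_trans (coord_le_norm (x - y) j) xy; rewrite !mxE.
Qed.

Section shift.
Variable t : R.
Local Notation cell := (skew_cell v j t).

(** [z] sits halfway through the slab number [a], and [e] is within a quarter of the step of it in
    the long direction, hence in the same slab. The crossing segment of the cell of [e] is then a
    small translate of the one centred at [z]. *)
Lemma slope_transfer (M rho : R) k (a : int) e z :
  `|e - z| <= rho -> along z + t = (a%:~R + 1 / 2) * 4 ^- k ->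
  4 * (rho / `|v ord0 j|) <= 4 ^- k ->
  slope D v j t k (cell k e) <= M ->
  D (z - (4 ^- k / 2) *: v) (z - (4 ^- k / 2) *: v + 4 ^- k *: v) <=
    4 ^- k * M + 2 * L * (16 ^- k + rho * (1 + `|v| / `|v ord0 j|)).
Proof.
have k0 : 0 < 4 ^+ k :> R by rewrite exprn_gt0.
have h0 : 0 < 4 ^- k :> R by rewrite invr_gt0.
move=> ez za small eM.
have ae := along_near ez.
have [th [th0 th1 thE eth]] := corner_near t vj k e.
have ce : (cell k e).1 = a.
  apply: floor_def; rewrite intrD.
  have -> : 4 ^+ k * (along e + t) = (a%:~R + 1 / 2) + 4 ^+ k * (along e - along z).
    have -> : along e + t = (along z + t) + (along e - along z) by ring.
    by rewrite za mulrDr mulrCA divff ?mulr1// gt_eqF.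
  have : `|4 ^+ k * (along e - along z)| <= 1 / 4.
    rewrite normrM (ger0_norm (ltW k0)) -ler_pdivlMl//; apply: le_trans ae _.
    by move: small; move: (rho / _) (4 ^- k) => x y; lra.
  by rewrite ler_norml; move: (4 ^+ k * _) => x /andP[? ?]; apply/andP; split; lra.
rewrite ce in thE.
have thd : `|th - 4 ^- k / 2| <= rho / `|v ord0 j|.
  rewrite (_ : th - _ = along e - along z)//.
  have -> : along z = (a%:~R + 1 / 2) * 4 ^- k - t by rewrite -za addrK.
  by rewrite thE; ring.
set c := cell k e in eth eM.
have near : `|z - (4 ^- k / 2) *: v - corner v j t k c| <=
    16 ^- k + rho * (1 + `|v| / `|v ord0 j|).
  rewrite (_ : z - _ - _ = (e - (corner v j t k c + th *: v)) + ((z - e) + (th - 4 ^- k / 2) *: v)).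
    apply: le_trans (ler_normD _ _) _; apply: lerD => //.
    apply: le_trans (ler_normD _ _) _; rewrite mulrDr mulr1; apply: lerD.
      by rewrite distrC.
    by rewrite normrZ mulrCA mulrC ler_wpM2l.
  by apply/rowP => i; rewrite !mxE; ring.
have near' : `|z - (4 ^- k / 2) *: v + 4 ^- k *: v - (corner v j t k c + 4 ^- k *: v)| <=
    16 ^- k + rho * (1 + `|v| / `|v ord0 j|).
  apply: le_trans near; rewrite le_eqVlt; apply/orP; left; apply/eqP; congr `|_|.
  by rewrite [corner _ _ _ _ _ + _]addrC addrKA.
apply: le_trans (pm_perturb HD near near') _.
have -> : D (corner v j t k c) (corner v j t k c + 4 ^- k *: v) = 4 ^- k * slope D v j t k c.
  by rewrite /slope mulrA mulVf ?mul1r// gt_eqF.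
apply: lerD; first by rewrite ler_wpM2l// ltW.
by rewrite le_eqVlt; apply/orP; left; apply/eqP; ring.
Qed.

Definition upper_slope (M e : R) (x : V) := exists2 r0 : R, 0 < r0 &
  forall r y s, 0 < r -> r < r0 -> `|y - x| <= r -> 0 <= s -> s <= r ->
    D y (y + s *: v) <= M * s + e * r.

(** A segment is replaced by a chain of crossings of consecutive slabs at a scale h much smaller
    than r. Nonporosity puts a point of [E] near the middle of each crossing, and [slope_transfer]
    bounds the crossing by [h * M] up to a small error. *)
Lemma nonporous_upper_slope (E : set V) (k0 : nat) (M e : R) x :
  0 <= M -> 0 < e -> e <= 1 ->
  (forall z k, E z -> (k0 <= k)%N -> slope D v j t k (cell k z) <= M) ->
  nonporous E x -> upper_slope M e x.
Proof.
move=> M0 e0 e1 EM Ex; have L0 := pm_const HD.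
pose W : R := 1 + `|v|.
pose cv : R := `|v ord0 j|.
have cv0 : 0 < cv by rewrite normr_gt0.
have W1 : 1 <= W by rewrite lerDl.
have vW : `|v| <= W by rewrite lerDr.
have W0 : 0 < W by apply: lt_le_trans W1.
have L1 : 0 < L + 1 by rewrite ltr_wpDl.
(* The step h is at most [kap * r], so that misaligning the two ends by [h * W] each costs at most
   half of [e * r]. *)
pose kap : R := e / (8 * (L + 1) * W).
have den0 : 0 < 8 * (L + 1) * W by rewrite !mulr_gt0.
have kap0 : 0 < kap by rewrite divr_gt0.
have kap1 : kap <= 1.
  rewrite ler_pdivrMr// mul1r (le_trans e1)// -[leLHS]mulr1 ler_pM//.
  by move: L0; lra.
(* The chain has at most 4 / kap crossings, and an error of 4 L mu r on each adds up to at most half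
   of [e * r]. *)
pose mu : R := kap * e / (32 * (L + 1)).
have mu0 : 0 < mu by apply: divr_gt0; apply: mulr_gt0.
pose X : R := 1 + W / cv.
have X1 : 1 <= X by rewrite lerDl divr_ge0 ?ltW.
have X0 : 0 < X by apply: lt_le_trans X1.
(* All midpoints lie within [3 * W * r] of [x]; nonporosity at that radius with this constant gives
   points of [E] within [rho = mu / X * r]. *)
have e2 : 0 < mu / (3 * W * X) by apply: divr_gt0 => //; rewrite !mulr_gt0.
have [rE rE0 Enear] := Ex _ e2.
exists (Num.min (Num.min (rE / (3 * W)) mu) (Num.min 1 (4 ^- k0))).
  by rewrite !lt_min ltr01 mu0 invr_gt0 exprn_gt0// !divr_gt0 ?mulr_gt0.
move=> r y s r0; rewrite !lt_min => /andP[/andP[rrE rmu] /andP[r1 rk0]] yx s0 sr.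
have kr0 : 0 < kap * r by rewrite mulr_gt0.
have kr1 : kap * r <= 1 by rewrite -[leRHS]mulr1 ler_pM ?(ltW r1)// ltW.
have [k' [kr rk]] := pow4_scale kr0 kr1.
pose k := k'.+1; pose h : R := 4 ^- k.
have h0 : 0 < h by rewrite invr_gt0 exprn_gt0.
have hr : h < kap * r by [].
have rh : kap * r <= 4 * h.
  by apply: le_trans rk _; rewrite /h exprS invfM mulrA divff ?mul1r.
have kk0 : (k0 <= k)%N.
  rewrite -(pow4_le R) -/h ltW// (lt_trans hr)// (le_lt_trans _ rk0)//.
  by rewrite ler_piMl// ltW.
have hle_r : h <= r by apply: le_trans (ltW hr) _; rewrite ler_piMl// ltW.
pose n := Num.truncn (s / h).
have /andP[ns sn] : n%:R * h <= s < (n%:R + 1) * h.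
  have sh0 : 0 <= s / h by rewrite divr_ge0// ltW.
  have /andP[n1 n2] := truncn_itv sh0.
  by rewrite -ler_pdivlMr// n1 -ltr_pdivrMr// natr1 n2.
pose a := Num.floor (4 ^+ k * (along y + t)).
(* Moving [y] by [th] along [v] reaches the next slab boundary, so that the pieces cross whole
   slabs. *)
pose th : R := (a + 1)%:~R * h - (along y + t).
have /andP[th0 th1] : 0 < th <= h.
  have /andP[a0 a1] : 0 <= along y + t - a%:~R * h < h.
    by apply: floor_mul; rewrite exprn_gt0.
  rewrite /th intrD mulrDl mul1r; move: a0 a1; move: (a%:~R * h) (along y + t) => u w.
  by move=> *; apply/andP; split; lra.
pose y0 := y + th *: v.
pose rho : R := mu / X * r.
have rho0 : 0 < rho by apply: mulr_gt0 => //; apply: divr_gt0.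
have rhoX : rho * X = mu * r by rewrite /rho mulrAC divfK// gt_eqF.
have step (i : 'I_n) : D (y0 + (i%:R * h) *: v) (y0 + (i.+1%:R * h) *: v) <=
    h * M + 2 * L * (2 * mu * r).
  pose z := y0 + ((i%:R + 1 / 2) * h) *: v.
  have in_ : i%:R + 1 <= n%:R :> R by rewrite natr1 ler_nat ltn_ord.
  have ih : (i%:R + 1 / 2) * h <= r.
    apply: le_trans (_ : n%:R * h <= r); last exact: le_trans ns sr.
    by rewrite ler_pM2r//; lra.
  have ih0 : 0 <= (i%:R + 1 / 2) * h by rewrite mulr_ge0 ?addr_ge0// ltW.
  have zx : `|z - x| <= 3 * W * r.
    rewrite (_ : z - x = (y - x) + (th + (i%:R + 1 / 2) * h) *: v); last first.
      by apply/rowP => l; rewrite !mxE; ring.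
    apply: le_trans (ler_normD _ _) _.
    apply: (@le_trans _ _ (r + (2 * r) * W)).
      have ti0 := addr_ge0 (ltW th0) ih0.
      apply: lerD => //; rewrite normrZ ler_pM// ger0_norm//.
      by rewrite mulr_natl mulr2n; apply: lerD => //; exact: le_trans th1 _.
    rewrite (_ : 3 * W * r = W * r + 2 * r * W); last by ring.
    by rewrite lerD2r ler_peMl// ltW.
  have [||u Eu uz] := Enear (3 * W * r) z _ _ zx.
  - by rewrite !mulr_gt0.
  - by rewrite mulrC -ltr_pdivlMr// mulr_gt0.
  have uz' : `|u - z| <= rho.
    apply: le_trans uz _; rewrite le_eqVlt; apply/orP; left; apply/eqP.
    by rewrite /rho; field; rewrite !gt_eqF.
  have za : along z + t = ((a + 1 + (i : nat)%:Z)%:~R + 1 / 2) * 4 ^- k.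
    rewrite /z /y0 !alongD /th -/h [in RHS]intrD; ring.
  have small : 4 * (rho / `|v ord0 j|) <= 4 ^- k.
    rewrite -/h -/cv.
    have : rho / cv <= mu * r.
      rewrite -rhoX ler_wpM2l ?(ltW rho0)// /X -[leLHS]mul1r.
      rewrite (@le_trans _ _ (W / cv))// ?lerDr// ler_wpM2r// invr_ge0 ltW//.
    have : 16 * (mu * r) <= kap * r.
      rewrite mulrA ler_wpM2r ?(ltW r0)// /mu.
      have : kap * e / (32 * (L + 1)) <= kap / 32.
        rewrite ler_pdivrMr ?mulr_gt0// (_ : kap / 32 * _ = kap * (L + 1)); last by field.
        by rewrite ler_wpM2l ?(ltW kap0)// (le_trans e1)// lerDr.
      move=> hk; apply: le_trans (ler_wpM2l _ hk) _ => //.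
      by rewrite mulrCA ler_piMr ?(ltW kap0)// ler_pdivrMr// mul1r ler_nat.
    by move: rh; move: (mu * r) (kap * r) (rho / cv) => A B C; lra.
  have := slope_transfer uz' za small (EM u k Eu kk0).
  have -> : z - (4 ^- k / 2) *: v = y0 + (i%:R * h) *: v.
    by rewrite /z -/h; apply/rowP => l; rewrite !mxE; ring.
  have -> : y0 + (i%:R * h) *: v + 4 ^- k *: v = y0 + (i.+1%:R * h) *: v.
    by rewrite -/h -addrA -scalerDl -natr1 mulrDl mul1r.
  rewrite -/h => hstep; apply: le_trans hstep _; rewrite lerD2l.
  rewrite ler_wpM2l ?mulr_ge0// -mulrA mulr_natl mulr2n lerD//.
    rewrite pow16E invfM -/h (le_trans (ler_pM (ltW h0) (ltW h0) hle_r hle_r))//.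
    by rewrite ler_wpM2r ?ltW.
  by rewrite -rhoX ler_wpM2l ?(ltW rho0)// lerD2l ler_wpM2r// invr_ge0.
have near1 : `|y - y0| <= h * W.
  by rewrite opprD addrA subrr add0r normrN normrZ ger0_norm ?(ltW th0)// ler_pM// ltW.
have near2 : `|y + s *: v - (y0 + (n%:R * h) *: v)| <= h * W.
  rewrite (_ : _ - _ = (s - th - n%:R * h) *: v); last first.
    by apply/rowP => l; rewrite !mxE; ring.
  rewrite normrZ ler_pM// ler_norml.
  by move: ns sn; rewrite mulrDl mul1r; move: (n%:R * h) => u *; apply/andP; split; lra.
apply: le_trans (pm_perturb HD near1 near2) _.
have chain := pm_chain HD v y0 h n.
have := le_trans chain (ler_sum _ (fun i _ => step i)).
rewrite sumr_const card_ord -[leRHS]mulr_natl => hD.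
have h2 : n%:R * (h * M + 2 * L * (2 * mu * r)) <= M * s + e / 2 * r.
  rewrite mulrDr; apply: lerD.
    by rewrite mulrA mulrC ler_wpM2l.
  have n4 : n%:R * kap <= 4.
    rewrite -(ler_pM2r r0) -mulrA (le_trans (ler_wpM2l _ rh))//.
    by rewrite mulrCA ler_wpM2l// (le_trans ns).
  have -> : n%:R * (2 * L * (2 * mu * r)) = (n%:R * kap) * (L / (L + 1)) * (e / 8) * r.
    by rewrite /mu; field; rewrite gt_eqF.
  rewrite ler_wpM2r ?(ltW r0)//.
  have LL : L / (L + 1) <= 1 by rewrite ler_pdivrMr// mul1r lerDl.
  have LL0 : 0 <= L / (L + 1) by rewrite divr_ge0// ltW.
  apply: (@le_trans _ _ (4 * 1 * (e / 8))).
    rewrite ler_wpM2r ?divr_ge0 ?(ltW e0)//; apply: ler_pM => //.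
    by rewrite mulr_ge0// ltW.
  by rewrite le_eqVlt; apply/orP; left; apply/eqP; field.
have : L * (h * W + h * W) <= e / 2 * r.
  apply: (@le_trans _ _ ((L + 1) * (2 * (kap * r * W)))).
    rewrite mulr_natl mulr2n ler_pM ?addr_ge0 ?mulr_ge0 ?(ltW h0) ?(ltW W0)// ?lerDl//.
    by apply: lerD; rewrite ler_wpM2r ?(ltW W0)// ltW.
  have -> : (L + 1) * (2 * (kap * r * W)) = e / 4 * r.
    by rewrite /kap; field; rewrite !gt_eqF.
  by rewrite ler_wpM2r ?(ltW r0)// ler_wpM2l ?(ltW e0)// lef_pV2 ?posrE// ler_nat.
have -> : e * r = e / 2 * r + e / 2 * r by field.
move=> h1; rewrite [X in _ <= X]addrA; apply: lerD => //.
exact: le_trans hD h2.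
Qed.

End shift.
End directional.

(** * Metric differentiability *)

Section differentiability.
Variables (R : realType) (d : nat) (L : R) (D : 'rV[R]_d -> 'rV[R]_d -> R).
Hypothesis HD : lip_pseudometric L D.
Local Notation V := 'rV[R]_d.

(** [x] and [x + s *: v] lie in one slab. The crossing segment there has slope at least M', while
    its parts before [x] and after [x + s *: v] have slope at most about M; what remains is a lower
    bound for the middle part. *)
Lemma lower_slope (v : V) (j : 'I_d) (t : R) (M M' e : R) (k : nat) (s r : R) x :
  v ord0 j != 0 ->
  (forall y u, `|y - x| <= r -> 0 <= u -> u <= r -> D y (y + u *: v) <= M * u + e * r) ->
  M' <= slope D v j t k (skew_cell v j t k x) ->
  Num.floor (4 ^+ k * (along v j x + t)) = Num.floor (4 ^+ k * (along v j x + s + t)) ->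
  0 <= s -> 4 ^- k * (1 + `|v|) <= r ->
  4 ^- k * M' <= M * (4 ^- k - s) + 2 * e * r + D x (x + s *: v) + 2 * L * 16 ^- k.
Proof.
move=> vj upper low same s0 kr.
have L0 := pm_const HD.
have k0 : 0 < 4 ^+ k :> R by rewrite exprn_gt0.
have [th [th0 th1 thE xth]] := corner_near t vj k x.
set c := skew_cell v j t k x in low thE xth.
have ths : th + s < 4 ^- k.
  have /andP[] := @floor_mul R (along v j x + s + t) (4 ^+ k) k0.
  rewrite -same -/(skew_cell v j t k x).1 -/c.1 => _ hh.
  by apply: le_lt_trans hh; rewrite thE le_eqVlt; apply/orP; left; apply/eqP; ring.
set h := 4 ^- k in th1 thE ths kr *.
have h0 : 0 < h by rewrite invr_gt0.
have hr : h <= r by apply: le_trans kr; rewrite ler_peMr ?(ltW h0)// lerDl.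
have vr u : 0 <= u -> u <= h -> `|u *: v| <= r.
  move=> u0 uh; apply: le_trans kr; rewrite normrZ ger0_norm// ler_pM//.
  by rewrite lerDr.
have hlow : h * M' <= D (corner v j t k c) (corner v j t k c + h *: v).
  apply: le_trans (ler_wpM2l (ltW h0) low) _.
  by rewrite /slope mulrA mulVf ?mul1r// gt_eqF.
apply: le_trans hlow _.
have near1 : `|corner v j t k c - (x - th *: v)| <= 16 ^- k.
  by rewrite distrC; apply: le_trans xth; rewrite opprD addrA addrAC.
have near2 : `|corner v j t k c + h *: v - (x + (h - th) *: v)| <= 16 ^- k.
  apply: le_trans near1; rewrite le_eqVlt; apply/orP; left; apply/eqP; congr `|_|.
  by apply/rowP => i; rewrite !mxE; ring.
apply: le_trans (pm_perturb HD near1 near2) _.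
have e1 : D (x - th *: v) x <= M * th + e * r.
  have := upper (x - th *: v) th; rewrite subrK; apply => //.
    by rewrite addrAC subrr add0r normrN vr// ltW.
  by rewrite (le_trans _ hr)// ltW.
have e2 : D (x + s *: v) (x + (h - th) *: v) <= M * (h - th - s) + e * r.
  rewrite (_ : x + (h - th) *: v = (x + s *: v) + (h - th - s) *: v); last first.
    by rewrite -addrA -scalerDl; congr (_ + _ *: _); ring.
  apply: upper.
  - by rewrite addrAC subrr add0r vr//; move: ths th0 s0; lra.
  - by move: ths; lra.
  - by move: hr s0 th0; lra.
have -> : L * (16 ^- k + 16 ^- k) = 2 * L * 16 ^- k by ring.
rewrite lerD2r.
rewrite (_ : M * (h - s) + _ + _ =
  (M * th + e * r) + (D x (x + s *: v) + (M * (h - th - s) + e * r))); last by ring.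
apply: le_trans (pm_triangle HD x _ _) _; apply: lerD => //.
by apply: le_trans (pm_triangle HD (x + s *: v) _ _) _; apply: lerD.
Qed.

(** [s] and [r] vary independently: with [y = x] and [u = r] this says that the quotients at [x]
    along [v] are Cauchy as the scale tends to 0. The other [y] and [u] extend the upper bound to
    all short segments near [x]. *)
Definition md_at (x v : V) := forall e : R, 0 < e ->
  exists2 r0 : R, 0 < r0 & forall s r y u, 0 < s -> s < r0 -> 0 < r -> r < r0 ->
    `|y - x| <= r -> 0 <= u -> u <= r ->
    D y (y + u *: v) <= (D x (x + s *: v) / s + e) * r.

Lemma md_at0 x : md_at x 0.
Proof.
move=> e e0; exists 1 => // s r y u s0 _ r0 _ _ _ _.
rewrite scaler0 addr0 (pm_refl HD) mulr_ge0 ?(ltW r0)// addr_ge0 ?(ltW e0)//.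
by rewrite divr_ge0 ?(ltW s0)// (pm_ge0 HD).
Qed.

(** Given [s], take a level with 3 s <= 4^-k < 12 s and the shift [b] for which [x] and [x + s *: v]
    share a slab. Then [lower_slope] bounds [M b] by the quotient at scale [s], and the upper slope
    [M b] holds at every other small scale [r]. *)
Lemma stable_slope_md (v : V) (j : 'I_d) (vj : v ord0 j != 0) (e eta : R) (M : bool -> R)
    (k0 : nat) (x : V) : 0 < e -> 0 < eta -> 200 * eta <= e ->
  (forall b, 0 <= M b) ->
  (forall b k, (k0 <= k)%N -> M b - 4 * eta <=
     slope D v j (b%:R / 3) k (skew_cell v j (b%:R / 3) k x)) ->
  (forall b eu, 0 < eu -> eu <= 1 -> upper_slope D v (M b) eu x) ->
  exists2 r0 : R, 0 < r0 & forall s r y u, 0 < s -> s < r0 -> 0 < r -> r < r0 ->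
    `|y - x| <= r -> 0 <= u -> u <= r ->
    D y (y + u *: v) <= (D x (x + s *: v) / s + e) * r.
Proof.
move=> e0 eta0 etae M0 low up; have L0 := pm_const HD.
pose W : R := 1 + `|v|.
have W1 : 1 <= W by rewrite lerDl.
have W0 : 0 < W by apply: lt_le_trans W1.
have L1 : 0 < L + 1 by rewrite ltr_wpDl.
(* The radius [12 * W * s] used for the upper slope multiplies [eu], so [eu * W] has to be small
   compared with [e]. *)
pose eu : R := Num.min 1 (e / (100 * W)).
have W100 : 0 < 100 * W by rewrite mulr_gt0.
have eu0 : 0 < eu by rewrite lt_min ltr01 divr_gt0.
have eu1 : eu <= 1 by rewrite ge_min lexx.
have euW : eu * W <= e / 100.
  apply: (@le_trans _ _ (e / (100 * W) * W)).
    by rewrite ler_wpM2r ?(ltW W0)// ge_min lexx orbT.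
  by rewrite le_eqVlt; apply/orP; left; apply/eqP; field; rewrite gt_eqF.
have eue : eu <= e / 100 by apply: le_trans euW; rewrite ler_peMr// ltW.
have [ra ra0 upa] := up false eu eu0 eu1.
have [rb rb0 upb] := up true eu eu0 eu1.
have [rm rm0 upm] : exists2 rm : R, 0 < rm & forall b r y s, 0 < r -> r < rm ->
    `|y - x| <= r -> 0 <= s -> s <= r -> D y (y + s *: v) <= M b * s + eu * r.
  exists (Num.min ra rb); first by rewrite lt_min ra0.
  by move=> b r y s r0; rewrite lt_min => /andP[h1 h2]; case: b; [exact: upb|exact: upa].
have W12 : 0 < 12 * W by rewrite mulr_gt0.
have L12 : 0 < (32 * 36) * (L + 1) by rewrite !mulr_gt0.
exists (Num.min (Num.min rm (rm / (12 * W))) (Num.min (4 ^- k0 / 3) (e / ((32 * 36) * (L + 1))))).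
  by rewrite !lt_min rm0 !divr_gt0 ?invr_gt0 ?exprn_gt0.
move=> s r y u s0 + r0; rewrite !lt_min => /andP[/andP[_ sW] /andP[sk sL]].
move=> /andP[/andP[rrm _] _] yx u0 ur.
have s30 : 0 < 3 * s by rewrite mulr_gt0.
have sk3 : 3 * s < 4 ^- k0 by rewrite mulrC -ltr_pdivlMr.
have s31 : 3 * s <= 1.
  by rewrite (le_trans (ltW sk3))// -[leRHS]invr1 -[X in _ <= X^-1](expr0 4) pow4_le.
have [k [ks sk']] := pow4_scale s30 s31.
have kk : (k0 <= k)%N.
  by have := lt_trans ks sk3; rewrite ltNge pow4_le -ltnNge ltnS.
have k12 : 4 ^- k <= 12 * s.
  by apply: ltW; move: ks; rewrite exprS invfM ltr_pdivrMl// mulrA -natrM.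
have h0 : 0 < 4 ^- k :> R by rewrite invr_gt0 exprn_gt0.
have [||b bE] := @third_shift R k (along v j x) (along v j x + s).
- by rewrite lerDl ltW.
- by rewrite [_ + s]addrC addrK.
have Mb : M b <= D x (x + s *: v) / s + 3 / 4 * e.
  pose r' := 12 * W * s.
  have r'0 : 0 < r' by rewrite mulr_gt0.
  have r'm : r' < rm by rewrite /r' mulrC -ltr_pdivlMr.
  have up' z w : `|z - x| <= r' -> 0 <= w -> w <= r' -> D z (z + w *: v) <= M b * w + eu * r'.
    by move=> *; apply: upm.
  have hr' : 4 ^- k * (1 + `|v|) <= r'.
    by rewrite /r' mulrAC ler_wpM2r// ltW.
  have main := lower_slope vj up' (low b k kk) bE (ltW s0) hr'.
  rewrite -(ler_pM2r s0) mulrDl divfK ?gt_eqF//.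
  have t1 : 4 ^- k * (4 * eta) <= 6 / 25 * e * s.
    apply: (@le_trans _ _ (12 * s * (4 * eta))); first by rewrite ler_wpM2r// mulr_ge0// ltW.
    rewrite (_ : 12 * s * (4 * eta) = 6 / 25 * (200 * eta) * s); last by field.
    by rewrite ler_wpM2r ?(ltW s0)// ler_wpM2l.
  have t2 : 2 * eu * r' <= 6 / 25 * e * s.
    rewrite (_ : 2 * eu * r' = 24 * (eu * W) * s); last by rewrite /r'; ring.
    rewrite ler_wpM2r ?(ltW s0)// (_ : 6 / 25 * e = 24 * (e / 100)); last by field.
    by rewrite ler_wpM2l.
  have t3 : 2 * L * 16 ^- k <= 1 / 4 * e * s.
    rewrite pow16E invfM.
    apply: (@le_trans _ _ (2 * L * ((12 * s) * (12 * s)))).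
      by rewrite ler_wpM2l ?mulr_ge0// ler_pM// ltW.
    rewrite (_ : 2 * L * _ = ((8 * 36) * L * s) * s); last by ring.
    rewrite ler_wpM2r ?(ltW s0)//.
    apply: (@le_trans _ _ ((8 * 36) * (L + 1) * s)).
      by rewrite ler_wpM2r ?(ltW s0)// ler_wpM2l// lerDl.
    move: sL; rewrite ltr_pdivlMr// => /ltW sL.
    rewrite (_ : (8 * 36) * (L + 1) * s = (s * ((32 * 36) * (L + 1))) / 4); last by field.
    by rewrite (_ : 1 / 4 * e = e / 4) ?ler_wpM2r//; field.
  have e1 : 4 ^- k * (M b - 4 * eta) = 4 ^- k * M b - 4 ^- k * (4 * eta) by ring.
  have e2 : M b * (4 ^- k - s) = 4 ^- k * M b - M b * s by ring.
  rewrite e1 e2 in main.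
  rewrite (_ : 3 / 4 * e * s = 6 / 25 * e * s + 6 / 25 * e * s + 1 / 4 * e * s + 1 / 50 * e * s); last by field.
  have es : 0 <= 1 / 50 * e * s by rewrite !mulr_ge0 ?(ltW e0) ?(ltW s0)// invr_ge0.
  apply: (@le_trans _ _ (4 ^- k * (4 * eta) + 2 * eu * r' + D x (x + s *: v) + 2 * L * 16 ^- k)).
    rewrite -subr_ge0 in main; rewrite -subr_ge0; apply: le_trans main _.
    by rewrite le_eqVlt; apply/orP; left; apply/eqP; ring.
  rewrite [leRHS](_ : _ = 6 / 25 * e * s + 6 / 25 * e * s + D x (x + s *: v) + (1 / 4 * e * s + 1 / 50 * e * s)); last by ring.
  by apply: lerD; [apply: lerD => //; apply: lerD|rewrite ler_wpDr].
apply: le_trans (upm b r y u r0 rrm yx u0 ur) _.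
rewrite mulrDl.
apply: (@le_trans _ _ (M b * r + eu * r)); first by rewrite lerD2r ler_wpM2l.
rewrite -!mulrDl ler_wpM2r ?(ltW r0)//.
apply: le_trans (lerD Mb eue) _; rewrite -addrA lerD2l.
rewrite -mulrA; move: e0; lra.
Qed.

End differentiability.

Section almost_everywhere.
Variables (R : realType) (d : nat) (L : R) (D : 'rV[R]_d -> 'rV[R]_d -> R).
Hypothesis HD : lip_pseudometric L D.
Local Notation V := 'rV[R]_d.
Hypothesis d_gt0 : (0 < d)%N.

(** Points are sorted into countably many sets [E i] by the limiting levels for the two shifts and
    by the level from which the slopes stay there. At a nonporous point of its own set, a point
    inherits the slope bounds of its neighbours. *)
Lemma md_at_direction_null (v : V) (j : 'I_d) : v ord0 j != 0 ->
  box_null [set x | ~ md_at D x v].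
Proof.
move=> vj; have L0 := pm_const HD.
have bw0 := box_weight0 R d_gt0.
pose md_eps (e : R) (x : V) := exists2 r0 : R, 0 < r0 & forall s r y u, 0 < s -> s < r0 -> 0 < r -> r < r0 ->
    `|y - x| <= r -> 0 <= u -> u <= r ->
    D y (y + u *: v) <= (D x (x + s *: v) / s + e) * r.
apply: (@null_sub _ _ _ _ _ (\bigcup_n [set x | ~ md_eps (4 ^- n) x])); last first.
  move=> x; apply: contra_notP => nx e e0.
  have [n ne] := pow4_small e0.
  have [r0 r00 hr] : md_eps (4 ^- n) x by apply: contrapT => h; apply: nx; exists n.
  exists r0 => // s r y u s0 sr r0' rr yx u0 ur; apply: le_trans (hr s r y u _ _ _ _ _ _ _) _ => //.
  by rewrite ler_wpM2r ?(ltW r0')// lerD2l.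
apply: null_bigcup; first exact: box_weight_ge0.
move=> n; set e : R := 4 ^- n.
have e0 : 0 < e by rewrite invr_gt0 exprn_gt0.
pose eta := e / 200.
have eta0 : 0 < eta by rewrite divr_gt0.
have etae : 200 * eta <= e by rewrite mulrC divfK.
pose lev (m : nat) : R := m%:R * eta - 12 * L - 1.
pose stab (b : bool) := [set x : V | exists m k0 : nat, forall k, (k0 <= k)%N ->
  `|slope D v j (b%:R / 3) k (skew_cell v j (b%:R / 3) k x) - lev m| <= 2 * eta].
pose E (i : {ffun bool -> nat} * nat) := [set x : V | forall (b : bool) k, (i.2 <= k)%N ->
  `|slope D v j (b%:R / 3) k (skew_cell v j (b%:R / 3) k x) - lev (i.1 b)| <= 2 * eta].
apply: (@null_sub _ _ _ _ _ ((\bigcup_b ~` stab b) `|`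
    (\bigcup_i [set x | E i x /\ ~ nonporous (E i) x]))).
  apply: (nullU (@box_weight_ge0 R d) bw0).
    apply: (null_bigcup_count (@box_weight_ge0 R d) bw0) => b.
    exact: (slope_stabilises HD _ vj eta0).
  apply: (null_bigcup_count (@box_weight_ge0 R d) bw0) => i.
  exact: nonporous_null.
move=> x; apply: contra_notP => /not_orP[nstab npor].
have st b : stab b x by apply: contrapT => h; apply: nstab; exists b.
have /choice[m /choice[k0 mk]] := st.
pose i : {ffun bool -> nat} * nat := ([ffun b => m b], maxn (k0 false) (k0 true)).
have Eix : E i x.
  move=> b k /=; rewrite geq_max => /andP[h1 h2]; rewrite ffunE; apply: mk.
  by case: b.
have por : nonporous (E i) x by apply: contrapT => h; apply: npor; exists i.
pose M (b : bool) := lev (i.1 b) + 2 * eta.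
have slope_up (b : bool) z k : E i z -> (i.2 <= k)%N ->
    slope D v j (b%:R / 3) k (skew_cell v j (b%:R / 3) k z) <= M b.
  by move=> /(_ b k) h /h; rewrite ler_distl => /andP[].
have M0 (b : bool) : 0 <= M b by apply: le_trans (slope_up b x i.2 Eix (leqnn _)); exact: (slope_ge0 HD).
apply: (stable_slope_md HD vj e0 eta0 etae M0 (k0 := i.2)).
  move=> b k ik; have := Eix b k ik; rewrite ler_distl => /andP[h _].
  by apply: le_trans h; rewrite /M; move: eta0; lra.
move=> b eu eu0 eu1; apply: (nonporous_upper_slope HD vj (M0 b) eu0 eu1 _ por).
by move=> z k; exact: slope_up.
Qed.

(** Replacing [v] by [w] changes every quotient by at most L |v - w|, at all scales alike, so a
    countable dense set of directions suffices. *)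
Lemma md_at_approx x (v : V) : (forall q : 'rV[rat]_d, md_at D x (map_mx (@ratr R) q)) ->
  md_at D x v.
Proof.
move=> mdq e e0; have L0 := pm_const HD.
have L1 : 0 < L + 1 by rewrite ltr_wpDl.
pose del := e / (4 * (L + 1)).
have del0 : 0 < del by apply: divr_gt0 => //; rewrite mulr_gt0.
have Ldel : L * del <= e / 4.
  apply: (@le_trans _ _ ((L + 1) * del)); first by rewrite ler_wpM2r ?(ltW del0)// lerDl.
  by rewrite le_eqVlt; apply/orP; left; apply/eqP; rewrite /del; field; rewrite gt_eqF.
have /choice[q0 q0P] : forall i : 'I_d, exists q : rat, `|v ord0 i - ratr q| <= del.
  move=> i; have /rat_in_itvoo[q] : v ord0 i - del < v ord0 i + del by lra.
  by rewrite in_itv /= => /andP[h1 h2]; exists q; rewrite ler_distl; apply/andP; split; lra.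
pose q : 'rV[rat]_d := \row_i q0 i; pose w : V := map_mx (@ratr R) q.
have vw : `|v - w| <= del.
  by apply: norm_le_coord => [|i]; [exact: ltW|rewrite !mxE].
have e20 : 0 < e / 2 by rewrite divr_gt0.
have [r0 r00 hr] := mdq q (e / 2) e20.
have close y s : 0 <= s -> `|(y + s *: v) - (y + s *: w)| <= s * del.
  by move=> s0; rewrite opprD addrACA subrr add0r -scalerBr normrZ ger0_norm// ler_wpM2l.
exists r0 => // s r y u s0 sr r0' rr yx u0 ur.
have h1 : D y (y + u *: v) <= D y (y + u *: w) + L * (u * del).
  have := @pm_perturb _ _ _ _ HD 0 (u * del) y (y + u *: v) y (y + u *: w).
  by rewrite subrr normr0 add0r; apply => //; exact: close.
have h2 : D x (x + s *: w) <= D x (x + s *: v) + L * (s * del).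
  have := @pm_perturb _ _ _ _ HD 0 (s * del) x (x + s *: w) x (x + s *: v).
  by rewrite subrr normr0 add0r; apply => //; rewrite distrC; apply: close; exact: ltW.
have h3 := hr s r y u s0 sr r0' rr yx u0 ur.
apply: le_trans h1 _; apply: le_trans (lerD h3 (_ : _ <= e / 4 * r)) _.
  rewrite mulrCA; apply: (@le_trans _ _ (u * (e / 4))); first by rewrite ler_wpM2l.
  by rewrite mulrC ler_wpM2l// divr_ge0// ltW.
rewrite -mulrDl ler_wpM2r ?(ltW r0')// -addrA.
have : D x (x + s *: w) / s <= D x (x + s *: v) / s + e / 4.
  rewrite ler_pdivrMr// mulrDl divfK ?gt_eqF// (le_trans h2)// lerD2l mulrCA mulrC.
  by rewrite ler_wpM2r// ltW.
move: (D x _ / s) (D x _ / s) => A B; lra.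
Qed.

Lemma md_at_null : box_null [set x | exists v, ~ md_at D x v].
Proof.
apply: (@null_sub _ _ _ _ _
    (\bigcup_(q : 'rV[rat]_d) [set x | ~ md_at D x (map_mx (@ratr R) q)])).
  apply: (null_bigcup_count (@box_weight_ge0 R d) (box_weight0 R d_gt0)) => q.
  have [->|q0] := eqVneq q 0.
    apply: (@null_sub _ _ _ _ _ set0).
      move=> e e0; apply: (covered0 _ (box_weight0 R d_gt0)); rewrite lee_fin; exact: ltW.
    by move=> x /=; rewrite map_mx0; apply; exact: (md_at0 HD).
  have [j qj] : exists j, q ord0 j != 0.
    apply: contrapT => h; move/eqP: q0; apply; apply/rowP => j; rewrite mxE.
    by apply/eqP; apply: contrapT => qj; apply: h; exists j; apply/negP.
  by apply: (md_at_direction_null (j := j)); rewrite mxE fmorph_eq0.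
move=> x [v nv]; apply: contrapT => h; apply: nv; apply: md_at_approx => q.
by apply: contrapT => nq; apply: h; exists q.
Qed.

End almost_everywhere.

(** * Degenerate directions *)

Section subspace.
Variables (F : fieldType) (d : nat) (K : 'rV[F]_d -> Prop).
Hypotheses (K0 : K 0) (KD : forall v w, K v -> K w -> K (v + w))
  (KZ : forall a v, K v -> K (a *: v)).

Lemma linear_pred_row_space : exists B : 'M[F]_d, forall v : 'rV[F]_d, K v <-> (v <= B)%MS.
Proof.
pose P r := `[< exists B : 'M[F]_d, \rank B = r /\ forall v, (v <= B)%MS -> K v >].
have exP : exists r, P r.
  exists 0%N; apply/asboolP; exists 0; rewrite mxrank0; split=> // v.
  by rewrite submx0 => /eqP ->.
have leP r : P r -> (r <= d)%N by move=> /asboolP[B [<- _]]; exact: rank_leq_row.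
case: (ex_maxnP exP leP) => r /asboolP[B [Br BK]] rmax; exists B => v; split => [Kv|]; last exact: BK.
have sub : (B <= B + v)%MS by exact: addsmxSl.
have Pv : P (\rank (B + v)%MS).
  apply/asboolP; exists (B + v)%MS; split => // w /sub_addsmxP[[a b] /= ->].
  apply: KD; first by apply: BK; exact: submxMl.
  by rewrite [b]mx11_scalar mul_scalar_mx; exact: KZ.
have : (B + v <= B)%MS.
  rewrite -(geq_leqif (mxrank_leqif_sup sub)) Br; exact: rmax.
exact: submx_trans (addsmxSr _ _).
Qed.

(** [row_ebase] completes a basis of the row space of [B] to a basis of the whole space, in which
    the row space is spanned by the leading vectors. *)
Lemma row_space_coordinates (B : 'M[F]_d) : exists2 Q : 'M[F]_d, Q \in unitmx &
  forall v : 'rV[F]_d, (v <= B)%MS <-> forall i : 'I_d, (\rank B <= i)%N -> (v *m invmx Q) ord0 i = 0.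
Proof.
exists (row_ebase B); first exact: row_ebase_unit.
move=> v; rewrite -(eq_row_base B) /row_base; split.
  move=> /submxP[a ->] i ri; rewrite mulmxA mulmxK ?row_ebase_unit// mxE big1// => k _.
  rewrite mxE; case: eqP => [ki|]; last by rewrite mulr0.
  by have := ltn_ord k; rewrite ki ltnNge ri.
move=> v0; apply/submxP; exists (v *m invmx (row_ebase B) *m pid_mx (\rank B)).
rewrite mulmxA -[_ *m pid_mx _ *m pid_mx _]mulmxA pid_mx_id ?rank_leq_row//.
rewrite (_ : v *m invmx (row_ebase B) *m pid_mx (\rank B) = v *m invmx (row_ebase B)).
  by rewrite mulmxKV// row_ebase_unit.
move: (v *m _) v0 => w w0; apply/rowP => i.
rewrite mxE (bigD1 i)//= mxE eqxx big1 => [|k ki]; last first.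
  by rewrite mxE -val_eqE /= in ki *; rewrite (negPf ki) mulr0.
rewrite addr0 /=; case: ltnP => [_|ri]; first by rewrite mulr1.
by rewrite w0// mul0r.
Qed.

Lemma row_space_chart (B : 'M[F]_d) (m : nat) (i0 : 'I_d) : (\rank B <= m)%N ->
  exists I : 'I_m -> 'I_d,
    forall v : 'rV[F]_d, (v <= B)%MS -> (forall l, v ord0 (I l) = 0) -> v = 0.
Proof.
move=> rm; pose A := (row_base B)^T.
have fA : row_full A by rewrite /row_full mxrank_tr; exact: row_base_free.
pose g := fullrankfun fA.
have gU := fullrowsub_unit fA.
(* Columns of a nonzero maximal minor of a basis separate the row space from 0; indices beyond the
   rank are padded with [i0]. *)
exists (fun l : 'I_m => if insub (l : nat) is Some k then g (k : 'I_(\rank B)) else i0) => v.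
rewrite -(eq_row_base B) => /submxP[c vc] vI.
suff c0 : c = 0 by rewrite vc c0 mul0mx.
have : c *m (rowsub g A)^T = 0.
  apply/rowP => k; rewrite [RHS]mxE.
  have := vI (widen_ord rm k).
  have -> : insub (widen_ord rm k : nat) = Some k by rewrite /= valK.
  rewrite vc mxE => e; rewrite -[RHS]e mxE; apply: eq_bigr => l _; rewrite !mxE.
  by congr (c _ _ * _); exact: val_inj.
move=> c0; have gU' : (rowsub g A)^T \in unitmx by rewrite unitmx_tr.
by rewrite -(mulmxK gU' c) c0 mul0mx.
Qed.

End subspace.

Lemma unit_ball_cluster (R : realType) (d : nat) (u : nat -> 'rV[R]_d) :
  (forall n, `|u n| <= 1) ->
  exists p : 'rV[R]_d, forall (e : R) n0, 0 < e -> exists2 n, (n0 <= n)%N & `|p - u n| < e.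
Proof.
move=> u1.
have cpt : compact [set p : 'rV[R]_d | `|p| <= 1].
  apply: bounded_closed_compact.
    exists 1; split; first exact: num_real.
    by move=> M M1 p /= p1; rewrite (le_trans p1)// ltW.
  apply: (@closed_comp _ _ (fun p : 'rV[R]_d => `|p|) [set x | x <= 1]).
    by move=> p _; exact: norm_continuous.
  exact: closed_le.
have [|p [_ clp]] := cpt (u @ \oo) _; first by exists 0%N => // n _; exact: u1.
exists p => e n0 e0.
have [|q [/= [n n0n <-] pq]] := clp (u @` [set n | (n0 <= n)%N]) (ball p e) _ (nbhsx_ballx p e e0).
  by exists n0 => // n n0n; exists n.
by exists n => //; rewrite -ball_normE in pq.
Qed.

Section kernel.
Variables (R : realType) (d : nat) (L : R) (D : 'rV[R]_d -> 'rV[R]_d -> R).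
Hypothesis HD : lip_pseudometric L D.
Local Notation V := 'rV[R]_d.
Variable x : V.
Hypothesis md : forall v, md_at D x v.

Definition md_kernel (v : V) := forall e : R, 0 < e -> exists2 r0 : R, 0 < r0 &
  forall s, 0 < s -> s < r0 -> D x (x + s *: v) <= e * s.

(** [md_at] spreads the vanishing from [x] to all base points near it; a negative multiple of [v] is
    traversed from its other end. *)
Lemma kernel_strong v (e : R) : md_kernel v -> 0 < e -> exists2 r0 : R, 0 < r0 &
  forall r y u, 0 < r -> r < r0 -> `|y - x| <= r -> `|u| <= r ->
  D y (y + u *: v) <= e * r.
Proof.
move=> Kv e0; pose W : R := 1 + `|v|.
have W1 : 1 <= W by rewrite lerDl.
have W0 : 0 < W by apply: lt_le_trans W1.
have e20 : 0 < e / (2 * W) by rewrite divr_gt0// mulr_gt0.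
have [r1 r10 h1] := md v e20; have [r2 r20 h2] := Kv _ e20.
have [s [s0 [s1 s2]]] : exists s, 0 < s /\ s < r1 /\ s < r2.
  exists (Num.min r1 r2 / 2); have m0 : 0 < Num.min r1 r2 by rewrite lt_min r10.
  split; first by rewrite divr_gt0.
  have : Num.min r1 r2 / 2 < Num.min r1 r2 by rewrite ltr_pdivrMr// ltr_pMr// ltr1n.
  by rewrite lt_min => /andP.
have pos r y u : 0 < r -> r < r1 -> `|y - x| <= r -> 0 <= u -> u <= r ->
    D y (y + u *: v) <= e / W * r.
  move=> r0 rr yx u0 ur; apply: le_trans (h1 s r y u s0 s1 r0 rr yx u0 ur) _.
  rewrite ler_wpM2r ?(ltW r0)//.
  rewrite (_ : e / W = e / (2 * W) + e / (2 * W)); last by field; rewrite gt_eqF.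
  by rewrite lerD2r ler_pdivrMr//; exact: h2.
exists (r1 / W); first by rewrite divr_gt0.
move=> r y u r0 rr yx ur.
have rW : r * W < r1 by rewrite -ltr_pdivlMr.
have rW0 : 0 < r * W by rewrite mulr_gt0.
have rrW : r <= r * W by rewrite ler_peMr// ltW.
have -> : e * r = e / W * (r * W) by field; rewrite gt_eqF.
have [u0|u0] := leP 0 u.
  apply: pos => //; first exact: le_trans rrW.
  by rewrite (le_trans (ler_norm u))// (le_trans ur).
rewrite (pm_sym HD).
have := pos (r * W) (y + u *: v) (- u) rW0 rW.
rewrite scaleNr addrK; apply.
- rewrite addrAC (le_trans (ler_normD _ _))// mulrDr mulr1 lerD// normrZ.
  by rewrite ler_wpM2r.
- by rewrite oppr_ge0 ltW.
- by rewrite (le_trans _ rrW)// (le_trans _ ur)// -normrN ler_norm.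
Qed.

Lemma kernel0 : md_kernel 0.
Proof.
move=> e e0; exists 1 => // s s0 _.
by rewrite scaler0 addr0 (pm_refl HD) mulr_ge0// ltW.
Qed.

Lemma kernelZ a v : md_kernel v -> md_kernel (a *: v).
Proof.
move=> Kv e e0; pose A : R := 1 + `|a|.
have A0 : 0 < A by rewrite ltr_wpDr.
have [r0 r00 h] := kernel_strong Kv (divr_gt0 e0 A0).
exists (r0 / A); first by rewrite divr_gt0.
move=> s s0 sr; rewrite scalerA.
have -> : e * s = e / A * (s * A) by field; rewrite gt_eqF.
apply: h.
- by rewrite mulr_gt0.
- by rewrite -ltr_pdivlMr.
- by rewrite subrr normr0 mulr_ge0// ltW.
- by rewrite normrM gtr0_norm// ler_wpM2l ?(ltW s0)// lerDr.
Qed.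

(** The path passes through [x + s *: v], so the vanishing along [w] is needed at a base point other
    than [x]. *)
Lemma kernelD v w : md_kernel v -> md_kernel w -> md_kernel (v + w).
Proof.
move=> Kv Kw e e0; pose A : R := 1 + `|v|.
have A1 : 1 <= A by rewrite lerDl.
have A0 : 0 < A by apply: lt_le_trans A1.
have e20 : 0 < e / 2 by rewrite divr_gt0.
have [r1 r10 h1] := Kv _ e20.
have [r2 r20 h2] := kernel_strong Kw (divr_gt0 e20 A0).
exists (Num.min r1 (r2 / A)); first by rewrite lt_min r10 divr_gt0.
move=> s s0; rewrite lt_min => /andP[s1 s2].
rewrite scalerDr addrA; apply: le_trans (pm_triangle HD (x + s *: v) _ _) _.
rewrite (_ : e * s = e / 2 * s + e / 2 / A * (s * A)); last by field; rewrite gt_eqF.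
apply: lerD; first exact: h1.
apply: h2.
- by rewrite mulr_gt0.
- by rewrite -ltr_pdivlMr.
- by rewrite addrAC subrr add0r normrZ gtr0_norm// ler_wpM2l ?(ltW s0)// lerDr.
- by rewrite gtr0_norm// ler_peMr// ltW.
Qed.

(** Metric differentiability makes the quotients converge, so smallness along some sequence of
    scales gives smallness at all small scales. *)
Lemma kernel_of_frequent v :
  (forall e r0 : R, 0 < e -> 0 < r0 -> exists s, [/\ 0 < s, s < r0 & D x (x + s *: v) <= e * s]) ->
  md_kernel v.
Proof.
move=> freq e e0; have e20 : 0 < e / 2 by rewrite divr_gt0.
have [r0 r00 h] := md v e20; exists r0 => // r rp rr.
have [s [s0 sr sD]] := freq _ _ e20 r00.
apply: le_trans (h s r x r s0 sr rp rr _ (ltW rp) (lexx _)) _.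
  by rewrite subrr normr0 ltW.
rewrite ler_wpM2r ?(ltW rp)// [leRHS]splitr lerD2r ler_pdivrMr//.
Qed.

(* The contingent directions of the level set [D x y = 0] lie in the kernel,
   which the coordinates [I] separate from [0]; hence the level set is a
   Lipschitz graph over these coordinates as seen from [x]. *)
Lemma level_chart (m : nat) (I : 'I_m -> 'I_d) :
  (forall v, md_kernel v -> (forall l, v ord0 (I l) = 0) -> v = 0) ->
  exists N : nat, forall y (r : R), `|y - x| <= 4 ^- N -> D x y = 0 -> 0 <= r ->
    (forall l, `|y ord0 (I l) - x ord0 (I l)| <= r) -> `|y - x| <= N%:R * r.
Proof.
move=> sep; have L0 := pm_const HD; apply: contrapT => nN.
have /choice[y yP] : forall N : nat, exists y : V, [/\ `|y - x| <= 4 ^- N, D x y = 0 &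
    exists2 r : R, 0 <= r & (forall l, `|y ord0 (I l) - x ord0 (I l)| <= r) /\ N%:R * r < `|y - x|].
  move=> N; apply: contrapT => h; apply: nN; exists N => y r yx Dxy r0 hr.
  by rewrite leNgt; apply/negP => hlt; apply: h; exists y; split => //; exists r.
pose t N := `|y N - x|.
have t0 N : 0 < t N.
  have [_ _ [r r0 [_ h]]] := yP N; apply: le_lt_trans h; exact: mulr_ge0.
pose u N := (t N)^-1 *: (y N - x).
have u1 N : `|u N| = 1.
  by rewrite normrZ ger0_norm ?invr_ge0 ?(ltW (t0 N))// mulVf// gt_eqF.
have [|p pP] := @unit_ball_cluster R d u; first by move=> N; rewrite u1.
have yE N : y N = x + t N *: u N.
  by rewrite scalerA divff ?gt_eqF// scale1r addrC subrK.
(* [y N] lies in the level set and is close to [x + t N *: p] whenever [u N] is close to [p]. This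
   controls [D] only at the scales [t N], which is enough by [kernel_of_frequent]. *)
have Kp : md_kernel p.
  apply: kernel_of_frequent => e r0 e0 r00.
  have L1 : 0 < L + 1 by rewrite ltr_wpDl.
  have r02 : 0 < r0 / 2 by rewrite divr_gt0.
  have [N0 hN0] := pow4_small r02.
  have [N NN pN] := pP _ N0 (divr_gt0 e0 L1).
  have [yN DN _] := yP N.
  exists (t N); split => //.
    apply: le_lt_trans yN _; apply: (@le_lt_trans _ _ (r0 / 2)).
      by apply: le_trans hN0; rewrite pow4_le.
    by rewrite ltr_pdivrMr// ltr_pMr// ltr1n.
  apply: le_trans (pm_triangle HD (y N) _ _) _; rewrite DN add0r.
  have : `|y N - (x + t N *: p)| <= t N * (e / (L + 1)).
    rewrite {1}yE opprD addrACA subrr add0r -scalerBr normrZ gtr0_norm//.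
    by rewrite ler_wpM2l ?(ltW (t0 N))// distrC ltW.
  move/(pm_near HD)/le_trans; apply.
  rewrite mulrCA mulrC ler_wpM2r ?(ltW (t0 N))// mulrCA ler_piMr ?(ltW e0)//.
  by rewrite ler_pdivrMr// mul1r lerDl.
have p0 : p = 0.
  apply: sep => // l; apply/eqP; rewrite -normr_le0; apply/ler_addgt0Pl => e e0.
  rewrite addr0; have e20 : 0 < e / 2 by rewrite divr_gt0.
  pose N0 := (Num.truncn (2 / e)).+1.
  have [N NN pN] := pP _ N0 e20.
  have N0e : 2 / e < N%:R.
    have d0 : 0 <= 2 / e by rewrite divr_ge0// ltW.
    have /andP[_ h] := truncn_itv d0.
    by apply: lt_le_trans h _; rewrite ler_nat.
  have N0' : 0 < N%:R :> R by apply: le_lt_trans N0e; rewrite divr_ge0// ltW.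
  have [_ _ [r r0 [hr Nr]]] := yP N.
  have uI : `|u N ord0 (I l)| <= e / 2.
    rewrite !mxE normrM ger0_norm ?invr_ge0 ?(ltW (t0 N))// mulrC ler_pdivrMr//.
    apply: le_trans (hr l) _.
    apply: (@le_trans _ _ (t N / N%:R)); first by rewrite ler_pdivlMr// mulrC ltW.
    rewrite mulrC ler_wpM2r ?(ltW (t0 N))// -[leRHS]invrK invf_div lef_pV2 ?posrE//.
      exact: ltW.
    by rewrite divr_gt0.
  have pu := le_trans (coord_le_norm (p - u N) (I l)) (ltW pN).
  rewrite !mxE in pu; rewrite [e]splitr.
  have -> : p ord0 (I l) = (p ord0 (I l) - u N ord0 (I l)) + u N ord0 (I l) by rewrite subrK.
  by apply: le_trans (ler_normD _ _) _; apply: lerD => //; rewrite !mxE.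
have [N _] := pP 1 0%N ltr01.
by rewrite p0 sub0r normrN u1 ltxx.
Qed.

End kernel.

(** * Points of positive density *)

Lemma common_threshold (R : realType) (J : finType) (P : J -> R -> Prop) :
  (forall j, exists2 r0 : R, 0 < r0 & forall r, 0 < r -> r < r0 -> P j r) ->
  exists2 r0 : R, 0 < r0 & forall r, 0 < r -> r < r0 -> forall j, P j r.
Proof.
move=> /(_ _)/cid2-/all_sig2[r_ r0 rP].
exists (\big[Num.min/1]_j r_ j); first by apply/bigmin_gtP.
by move=> r r0' /bigmin_gtP[_ rr] j; apply: rP => //; exact: rr.
Qed.

Lemma mulmx_bound (R : realType) (d : nat) (M : 'M[R]_d) :
  exists2 C : R, 0 < C & forall w : 'rV_d, `|w *m M| <= C * `|w|.
Proof.
pose C : R := 1 + \sum_i \sum_k `|M i k|.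
have S0 : 0 <= \sum_i \sum_k `|M i k| by apply: sumr_ge0 => i _; apply: sumr_ge0.
exists C => [|w]; first by rewrite ltr_wpDr.
apply: norm_le_coord => [|k]; first by rewrite mulr_ge0// addr_ge0.
rewrite mxE; apply: le_trans (ler_norm_sum _ _ _) _.
apply: (@le_trans _ _ ((\sum_i `|M i k|) * `|w|)).
  rewrite mulr_suml; apply: ler_sum => i _.
  by rewrite normrM mulrC ler_wpM2l// coord_le_norm.
rewrite ler_wpM2r// (le_trans _ (_ : \sum_i \sum_k `|M i k| <= _)) ?lerDr//.
apply: ler_sum => i _; rewrite (bigD1 k)//= lerDl; exact: sumr_ge0.
Qed.

Section uniform_kernel.
Variables (R : realType) (d : nat) (L : R) (D : 'rV[R]_d -> 'rV[R]_d -> R).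
Hypothesis HD : lip_pseudometric L D.
Local Notation V := 'rV[R]_d.
Variable x : V.
Hypothesis md : forall v, md_at D x v.
Variables (rho : nat) (Q : 'M[R]_d).
Hypothesis Qker : forall i : 'I_d, (i < rho)%N -> md_kernel D x (row i Q).

(** The displacement is made one basis vector at a time. The intermediate points drift by at most
    the factor [C] from the ball of radius [r], and the d steps share the error. *)
Lemma kernel_uniform (e : R) : 0 < e -> exists2 r0 : R, 0 < r0 &
  forall r, 0 < r -> r < r0 -> forall (y w : V), `|y - x| <= r -> `|w| <= r ->
    (forall i : 'I_d, (rho <= i)%N -> w ord0 i = 0) ->
    D y (y + w *m Q) <= e * r.
Proof.
move=> e0.
pose S : R := \sum_i `|row i Q|.
have S0 : 0 <= S by exact: sumr_ge0.
pose C : R := 1 + S.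
have C1 : 1 <= C by rewrite lerDl.
have C0 : 0 < C by apply: lt_le_trans C1.
have d1 : 0 < d.+1%:R :> R by rewrite ltr0n.
have e10 : 0 < e / (d.+1%:R * C) by rewrite divr_gt0// mulr_gt0.
pose P (i : 'I_d) (r : R) := (i < rho)%N -> forall y u, `|y - x| <= r -> `|u| <= r ->
  D y (y + u *: row i Q) <= e / (d.+1%:R * C) * r.
have [r1 r10 h1] : exists2 r0 : R, 0 < r0 & forall r, 0 < r -> r < r0 -> forall i, P i r.
  apply: common_threshold => i; have [ir|ri] := ltnP i rho; last first.
    by exists 1 => // r _ _; rewrite /P ltnNge ri.
  have [r0 r00 h] := kernel_strong HD md (Qker ir) e10.
  by exists r0 => // r rp rr _ y u; exact: h.
exists (r1 / C); first by rewrite divr_gt0.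
move=> r r0 rr y w yx wr w0.
have rC0 : 0 < r * C by rewrite mulr_gt0.
have rC : r * C < r1 by rewrite -ltr_pdivlMr.
have rrC : r <= r * C by rewrite ler_peMr// ltW.
pose z k : V := y + \sum_(i < d | (i < k)%N) w ord0 i *: row i Q.
have zx k : `|z k - x| <= r * C.
  rewrite /z addrAC mulrDr mulr1; apply: le_trans (ler_normD _ _) _; apply: lerD => //.
  apply: le_trans (ler_norm_sum _ _ _) _; rewrite /S mulr_sumr big_mkcond /=.
  apply: ler_sum => i _; case: ifP => _; last by rewrite mulr_ge0// ltW.
  rewrite normrZ ler_wpM2r//; exact: le_trans (coord_le_norm _ _) wr.
have zS (i : 'I_d) : z i.+1 = z i + w ord0 i *: row i Q.
  rewrite /z -addrA; congr (_ + _); rewrite (bigD1 i)//= addrC; congr (_ + _).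
  by apply: eq_bigl => l; rewrite ltnS ltn_neqAle andbC -val_eqE.
have Dz k : (k <= d)%N -> D y (z k) <= k%:R * (e / (d.+1%:R * C) * (r * C)).
  elim: k => [_|k IH kd].
    by rewrite /z big_pred0// addr0 (pm_refl HD) mul0r.
  apply: le_trans (pm_triangle HD (z k) _ _) _.
  rewrite -natr1 mulrDl mul1r; apply: lerD; first exact: IH (ltnW kd).
  rewrite (zS (Ordinal kd)) /=.
  have [kr|rk] := ltnP k rho.
    apply: (h1 (r * C) rC0 rC (Ordinal kd)) => //.
    by apply: le_trans rrC; exact: le_trans (coord_le_norm _ _) wr.
  rewrite w0// scale0r addr0 (pm_refl HD) mulr_ge0// ltW//.
have -> : y + w *m Q = z d.
  rewrite /z mulmx_sum_row; congr (_ + _); by apply: eq_bigl => i; rewrite ltn_ord.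
apply: le_trans (Dz d (leqnn d)) _.
rewrite (_ : e / _ * _ = e * r / d.+1%:R); last by field; rewrite !gt_eqF.
rewrite mulrCA ler_piMr ?mulr_ge0 ?(ltW e0) ?(ltW r0)// ler_pdivrMr// mul1r ler_nat.
exact: leqnSn.
Qed.

End uniform_kernel.

(** * Hausdorff content through weighted covers *)

Section hausdorff_covers.
Variables (R : realType) (X : metricType R).
Implicit Types E : set X.

Definition diam_pow (n : nat) E : \bar R := (diam E ^+ n)%E.

Definition hcovered (n : nat) := covered (fun E : set X => E) (diam_pow n).

Lemma diam_ge0 E : (0 <= diam E)%E.
Proof. by rewrite /diam le_max lexx. Qed.

Lemma diam_pow_ge0 n E : (0 <= diam_pow n E)%E.
Proof. by rewrite /diam_pow expe_ge0// diam_ge0. Qed.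

Lemma diam_le E (r : R) : 0 <= r -> (forall y z, E y -> E z -> mdist y z <= r) ->
  (diam E <= r%:E)%E.
Proof.
move=> r0 Er; rewrite /diam ge_max lee_fin r0 /=.
by apply: ge_ereal_sup => _ [[y z] [Ey Ez] <-]; rewrite lee_fin; exact: Er.
Qed.

Lemma diam_pow0 n : (0 < n)%N -> diam_pow n set0 = 0%E.
Proof.
move=> n0; apply/eqP; rewrite expe_eq0 n0 eq_le diam_ge0 andbT.
exact: diam_le.
Qed.

Lemma diam_pow_le n E (r : R) : 0 <= r -> (forall y z, E y -> E z -> mdist y z <= r) ->
  (diam_pow n E <= (r ^+ n)%:E)%E.
Proof.
move=> r0 Er; rewrite /diam_pow EFin_expe; have h := diam_le r0 Er.
elim: n => // n IH; rewrite !expeS; apply: lee_pmul => //.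
  exact: diam_ge0.
by apply: expe_ge0; exact: diam_ge0.
Qed.

Lemma omega_ge0 n : 0 <= omega R n.
Proof.
apply: fine_ge0; apply: le_ereal_inf_tmp => _ [a [b [ab _ ->]]].
apply: nneseries_ge0 => k _ _; rewrite lee_fin; apply: prodr_ge0 => i _.
by rewrite subr_ge0.
Qed.

Lemma hcovered_content n E a : hcovered n E a ->
  (hausdorff_content n E <= (omega R n / 2 ^+ n)%:E * a)%E.
Proof.
move=> [u [Eu ua]]; apply: le_trans (ereal_inf_lbound _) _.
  by exists u => //; exact: Eu.
by apply: lee_wpmul2l => //; rewrite lee_fin divr_ge0 ?omega_ge0 ?exprn_ge0.
Qed.

End hausdorff_covers.

Lemma euclidean_coord (R : realType) (d : nat) (x y : euclidean R d) (i : 'I_d) :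
  `|x ord0 i - y ord0 i| <= mdist x y.
Proof.
rewrite /mdist /= /euclidean_dist -sqrtr_sqr; apply: ler_wsqrtr.
rewrite (bigD1 i)//= lerDl; apply: sumr_ge0 => k _; exact: sqr_ge0.
Qed.

Lemma norm_le_euclidean (R : realType) (d : nat) (x y : 'rV[R]_d) :
  `|x - y| <= mdist (x : euclidean R d) (y : euclidean R d).
Proof.
apply: norm_le_coord => [|i]; first exact: mdist_ge0.
rewrite !mxE; exact: (@euclidean_coord R d x y i).
Qed.

Lemma euclidean_le_norm (R : realType) (d : nat) (x y : 'rV[R]_d) :
  mdist (x : euclidean R d) (y : euclidean R d) <= d%:R * `|x - y|.
Proof.
rewrite /mdist /= /euclidean_dist.
have d0 : 0 <= d%:R * `|x - y| by rewrite mulr_ge0.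
rewrite -(ger0_norm d0) -sqrtr_sqr; apply: ler_wsqrtr.
apply: (@le_trans _ _ (\sum_(i < d) `|x - y| ^+ 2)).
  apply: ler_sum => i _; rewrite -[leLHS]real_normK ?num_real// ler_sqr ?nnegrE//.
  by have := coord_le_norm (x - y) i; rewrite !mxE.
rewrite sumr_const card_ord -[leLHS]mulr_natl exprMn ler_wpM2r ?sqr_ge0//.
by rewrite -natrX ler_nat; case: (d) => // k; rewrite expnS leq_pmulr.
Qed.

Section collapse.
Variables (R : realType) (d : nat) (L : R) (D : 'rV[R]_d -> 'rV[R]_d -> R).
Hypothesis HD : lip_pseudometric L D.
Local Notation V := 'rV[R]_d.
Variables (X : metricType R) (A : set V) (f : V -> X).
Hypothesis fD : forall y z, A y -> A z -> mdist (f y) (f z) <= D y z.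
Variable x : V.
Hypothesis md : forall v, md_at D x v.
Variable B : 'M[R]_d.
Hypothesis BK : forall v, md_kernel D x v <-> (v <= B)%MS.

Lemma same_slot (c c' a : R) (N : nat) : 0 < a -> (0 < N)%N -> `|c| < a -> `|c'| < a ->
  Num.truncn ((c + a) / (2 * a) * N%:R) = Num.truncn ((c' + a) / (2 * a) * N%:R) ->
  `|c - c'| <= 2 * a / N%:R.
Proof.
move=> a0 N0; rewrite !ltr_norml => /andP[c1 c2] /andP[d1 d2].
have N0' : 0 < N%:R :> R by rewrite ltr0n.
have a20 : 0 < 2 * a by rewrite mulr_gt0.
pose g (u : R) := (u + a) / (2 * a) * N%:R.
have g0 u : - a < u -> 0 <= g u.
  by move=> h; rewrite mulr_ge0// divr_ge0 ?(ltW a20)//; move: h; lra.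
have /andP[t1 t2] := truncn_itv (g0 c c1); have /andP[t3 t4] := truncn_itv (g0 c' d1).
rewrite -/(g c) -/(g c') => e; rewrite e in t1 t2; rewrite -natr1 in t2 t4.
have -> : c - c' = (g c - g c') * (2 * a / N%:R).
  by rewrite /g; field; rewrite !gt_eqF.
rewrite normrM (ger0_norm (_ : 0 <= 2 * a / N%:R)); last by rewrite divr_ge0 ?ltW.
rewrite ler_piMl ?divr_ge0 ?(ltW a20) ?(ltW N0')//.
rewrite ler_norml; move: t1 t2 t3 t4; move: (g c) (g c') => *; apply/andP; split; lra.
Qed.

Lemma slot_lt (c a : R) (N : nat) : 0 < a -> `|c| < a ->
  (Num.truncn ((c + a) / (2 * a) * N.+1%:R) < N.+1)%N.
Proof.
move=> a0; rewrite ltr_norml => /andP[c1 c2].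
have a20 : 0 < 2 * a by rewrite mulr_gt0.
have g0 : 0 <= (c + a) / (2 * a) * N.+1%:R.
  by rewrite mulr_ge0// divr_ge0 ?(ltW a20)//; move: c1; lra.
have /andP[t1 _] := truncn_itv g0.
rewrite -(ltr_nat R) (le_lt_trans t1)// gtr_pMl ?ltr0n// ltr_pdivrMr//.
by rewrite mul1r; move: c2; lra.
Qed.

(** In the coordinates [Q], moving along the kernel costs almost nothing, and at most n - 1
    coordinates remain. Cutting each into N + 1 slots gives at most (N + 1)^(n - 1) pieces with
    image of diameter at most [C3 * r / (N + 1)], hence total weight at most [C3 ^+ n / (N + 1)]
    times [r ^+ n]. *)
Lemma collapsed_cover (n : nat) (n_gt0 : (0 < n)%N) (rank_lt : (d < n + \rank B)%N) (e : R) :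
  0 < e -> exists2 r0 : R, 0 < r0 & forall r, 0 < r -> r < r0 ->
  hcovered n (f @` ([set y | `|y - x| < r] `&` A)) (e * r ^+ n)%:E.
Proof.
move=> e0; have L0 := pm_const HD.
have [Q Qu QB] := row_space_coordinates B.
pose rho : nat := \rank B.
have [C1 C10 hC1] := mulmx_bound (invmx Q).
have [C2 C20 hC2] := mulmx_bound Q.
have Qker (i : 'I_d) : (i < rho)%N -> md_kernel D x (row i Q).
  move=> ir; apply/BK/QB => l rl; rewrite rowE mulmxK// mxE eqxx /=.
  by rewrite -val_eqE /=; case: eqP => // li; move: ir; rewrite -li ltnNge rl.
(* The first term pays for flattening both points onto the non-kernel coordinates, the second for
   the distance between the flattened points of one slot. *)
pose C3 : R := 2 * (1 + C1) + L * (C2 * (2 * C1)).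
have C30 : 0 < C3.
  by rewrite ltr_pwDl ?mulr_gt0 ?addr_gt0// mulr_ge0// mulr_ge0 ?(ltW C20)// mulr_ge0// ltW.
have [N hN] : exists N : nat, C3 ^+ n / N.+1%:R <= e.
  exists (Num.truncn (C3 ^+ n / e)).
  have q0 : 0 <= C3 ^+ n / e by rewrite divr_ge0 ?exprn_ge0// ltW.
  have /andP[_ h] := truncn_itv q0.
  by rewrite ler_pdivrMr ?ltr0n// mulrC -ler_pdivrMr// ltW.
have N0 : 0 < N.+1%:R :> R by rewrite ltr0n.
have N0V : 0 < N.+1%:R^-1 :> R by rewrite invr_gt0.
have [r1 r10 hK] := kernel_uniform HD md Qker N0V.
have C11 : 0 < 1 + C1 by rewrite addr_gt0.
exists (r1 / (1 + C1)); first by rewrite divr_gt0.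
move=> r r0; rewrite ltr_pdivlMr// => rr.
pose a : R := C1 * r; have a0 : 0 < a by rewrite mulr_gt0.
pose c (y : V) : V := (y - x) *m invmx Q.
have c_lt y i : `|y - x| < r -> `|c y ord0 i| < a.
  move=> yx; apply: le_lt_trans (coord_le_norm _ _) _.
  by apply: le_lt_trans (hC1 _) _; rewrite /a ltr_pM2l.
have shift (l : 'I_(d - rho)) : (l + rho < d)%N.
  by have := ltn_ord l; rewrite ltn_subRL addnC.
pose J := {ffun 'I_(d - rho) -> 'I_N.+1}.
pose slot (y : V) (i : 'I_d) := Num.truncn ((c y ord0 i + a) / (2 * a) * N.+1%:R).
pose piece (k : J) := [set y | [/\ `|y - x| < r, A y &
  forall l, slot y (Ordinal (shift l)) = k l]].
pose s : R := C3 * r / N.+1%:R.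
have s0 : 0 <= s by rewrite !mulr_ge0 ?(ltW C30) ?(ltW r0)// ltW.
have piece_diam k : (diam_pow n (f @` piece k) <= (s ^+ n)%:E)%E.
  apply: diam_pow_le => // _ _ [y [yx Ay yk] <-] [z [zx Az zk] <-].
  apply: le_trans (fD Ay Az) _.
  (* Adding [head (c y) *m Q] to [y] resets its kernel coordinates to those of [x]. *)
  pose head (w : V) : V := \row_i (if (i < rho)%N then - w ord0 i else 0).
  have yQ (y' : V) : y' = x + c y' *m Q by rewrite mulmxKV// addrC subrK.
  have r'0 : 0 < r * (1 + C1) by rewrite mulr_gt0.
  have flat y' : `|y' - x| < r ->
      D y' (y' + head (c y') *m Q) <= N.+1%:R^-1 * (r * (1 + C1)).
    move=> yx'; apply: (hK (r * (1 + C1)) r'0 rr).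
    - by rewrite (le_trans (ltW yx'))// ler_peMr ?(ltW r0)// lerDl ltW.
    - apply: norm_le_coord => [|i]; first exact: ltW.
      rewrite mxE; case: ifP => _; last by rewrite normr0 ltW.
      rewrite normrN (le_trans (ltW (c_lt _ _ yx')))// /a mulrC ler_wpM2l ?(ltW r0)//.
      by rewrite lerDr.
    - by move=> i ri; rewrite mxE ltnNge ri.
  have near : `|(y + head (c y) *m Q) - (z + head (c z) *m Q)| <= C2 * (2 * a / N.+1%:R).
    rewrite {1}(yQ y) {1}(yQ z).
    rewrite (_ : _ - _ = ((c y + head (c y)) - (c z + head (c z))) *m Q); last first.
      rewrite mulmxBl !mulmxDl.
      have sub_x (p q p' q' : V) : x + p + q - (x + p' + q') = p + q - (p' + q').
        by apply/rowP => i; rewrite !mxE; ring.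
      exact: sub_x.
    apply: le_trans (hC2 _) _; rewrite ler_wpM2l ?(ltW C20)//.
    have aN : 0 <= 2 * a / N.+1%:R by rewrite divr_ge0 ?mulr_ge0// ltW.
    have headE w i : head w ord0 i = if (i < rho)%N then - w ord0 i else 0 by rewrite mxE.
    have addE (p q p' q' : V) i : (p + q - (p' + q')) ord0 i =
        p ord0 i + q ord0 i - (p' ord0 i + q' ord0 i) by rewrite !mxE.
    apply: norm_le_coord => // i; rewrite addE !headE; case: ltnP => ri.
      by rewrite !subrr normr0.
    rewrite !addr0; apply: (same_slot a0) => //; [exact: c_lt|exact: c_lt|].
    have li : (i - rho < d - rho)%N by rewrite ltn_sub2r// (leq_ltn_trans ri).
    have -> : i = Ordinal (shift (Ordinal li)) by apply: val_inj => /=; rewrite subnK.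
    by rewrite -/(slot y _) -/(slot z _) yk zk.
  apply: le_trans (pm_triangle HD (y + head (c y) *m Q) _ _) _.
  apply: le_trans (lerD (flat y yx) (pm_triangle HD (z + head (c z) *m Q) _ _)) _.
  rewrite (pm_sym HD _ z).
  apply: le_trans (lerD (lexx _) (lerD (pm_near HD near) (flat z zx))) _.
  by rewrite le_eqVlt; apply/orP; left; apply/eqP; rewrite /s /C3 /a; field; rewrite gt_eqF.
have w0 := @diam_pow_ge0 R X n.
have s0' (k : J) : (0 <= (s ^+ n)%:E)%E by rewrite lee_fin exprn_ge0.
have cov (k : J) : hcovered n (f @` piece k) (s ^+ n)%:E.
  have := covered1 (fun E : set X => E) w0 (diam_pow0 X n_gt0) (f @` piece k).
  by move/covered_sub; apply => //.
have /covered_sub := covered_finite w0 (diam_pow0 X n_gt0) s0' cov; apply.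
  move=> _ [y [/= yx Ay] <-].
  have sl l : (slot y (Ordinal (shift l)) < N.+1)%N by apply: slot_lt => //; exact: c_lt.
  exists [ffun l => Ordinal (sl l)] => //; exists y => //; split => // l.
  by rewrite ffunE.
rewrite sumEFin lee_fin sumr_const card_ffun !card_ord -[leLHS]mulr_natl natrX.
have -> : s ^+ n = (C3 * r) ^+ n * (N.+1%:R ^- n) by rewrite /s exprMn exprVn.
rewrite mulrCA exprMn.
have -> : C3 ^+ n * r ^+ n * (N.+1%:R ^+ (d - rho) * N.+1%:R ^- n) =
  (C3 ^+ n * (N.+1%:R ^+ (d - rho) * N.+1%:R ^- n)) * r ^+ n by ring.
rewrite ler_wpM2r ?exprn_ge0 ?(ltW r0)// (le_trans _ hN)//.
rewrite ler_wpM2l ?exprn_ge0 ?(ltW C30)// ler_pdivrMr ?exprn_gt0//.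
rewrite ler_pdivlMl// -exprS ler_weXn2l ?ler1n//.
by rewrite ltn_subLR ?rank_leq_row// addnC.
Qed.

End collapse.

Section density.
Variables (R : realType) (k n : nat) (X : metricType R).
Variables (A : set (euclidean R k)) (f : euclidean R k -> X) (x : 'rV[R]_k).

Lemma upper_density_collapsed :
  (forall e : R, 0 < e -> exists2 r0 : R, 0 < r0 & forall r, 0 < r -> r < r0 ->
    hcovered n (f @` ([set y : 'rV[R]_k | `|y - x| < r] `&` A)) (e * r ^+ n)%:E) ->
  ~ (0 < upper_density n A f x)%E.
Proof.
move=> cov; apply/negP; rewrite -leNgt; apply/lee_addgt0Pr => e e0; rewrite add0e.
have [r0 r00 h] := cov e e0.
apply: le_trans (ereal_inf_lbound _) _.
  exists [set r | 0 < r < r0]; last by [].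
  have hg := nbhs_right_gt (0 : R); have hl := nbhs_right_lt r00.
  by apply: filterS2 hg hl => r h1 h2; apply/andP.
apply: ge_ereal_sup => _ [r /= /andP[rp rr] <-].
have om := omega_ge0 R n.
have content_le : (hausdorff_content n (f @` (ball (x : euclidean R k) r `&` A)) <=
    (omega R n / 2 ^+ n)%:E * (e * r ^+ n)%:E)%E.
  apply: hcovered_content; apply: covered_sub (h r rp rr) _ (lexx _).
  move=> _ [y [xy Ay] <-]; exists y => //; split => //=.
  rewrite ballEmdist /= in xy; rewrite distrC; apply: le_lt_trans xy.
  exact: (@norm_le_euclidean R k x y).
have inv0 : (0 <= ((omega R n * r ^+ n)^-1)%:E)%E.
  by rewrite lee_fin invr_ge0 mulr_ge0// exprn_ge0// ltW.
apply: le_trans (lee_wpmul2r inv0 content_le) _.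
rewrite -!EFinM lee_fin.
(* If [omega R n] were 0 the quotient would vanish; this case spares a computation of the volume of
   the ball. *)
have [->|om0] := eqVneq (omega R n) 0; first by rewrite !mul0r ltW.
have rn0 : 0 < r ^+ n by rewrite exprn_gt0.
rewrite (_ : _ / _ * _ * _ = e / 2 ^+ n); last first.
  by field; rewrite om0 expf_neq0 ?gt_eqF.
by rewrite ler_piMr ?(ltW e0)// invf_le1 ?exprn_gt0// exprn_ege1// ler1n.
Qed.

End density.

(** * Extension of the pulled back distance to the whole space *)

Section gluing.
Variables (R : realType) (d : nat) (X : metricType R).
Variables (A : set 'rV[R]_d) (f : 'rV[R]_d -> X) (L : R).
Hypothesis L_ge0 : 0 <= L.
Hypothesis f_lip : forall y z, A y -> A z -> mdist (f y) (f z) <= L * `|y - z|.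

(** The infimum of these lengths is the largest pseudometric below [L] times the norm and below the
    pulled back distance on [A]. One passage through [X] is enough, because [f] is [L]-Lipschitz on
    [A]. *)
Definition glued_paths (y z : 'rV[R]_d) : set R := [set s | s = L * `|y - z| \/
  exists a b, [/\ A a, A b & s = L * `|y - a| + mdist (f a) (f b) + L * `|b - z|]].

Definition glued_dist (y z : 'rV[R]_d) : R := inf (glued_paths y z).

Let paths_ge0 y z s : glued_paths y z s -> 0 <= s.
Proof.
move=> [->|[a [b [_ _ ->]]]]; first by rewrite mulr_ge0.
by rewrite !addr_ge0 ?mulr_ge0 ?mdist_ge0.
Qed.

Let glued_le y z s : glued_paths y z s -> glued_dist y z <= s.
Proof. by move=> h; apply: ge_inf => //; exists 0 => t /paths_ge0. Qed.

Let le_glued y z t : (forall s, glued_paths y z s -> t <= s) -> t <= glued_dist y z.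
Proof. by move=> h; apply: lb_le_inf => //; exists (L * `|y - z|); left. Qed.

Let paths_triangle y1 y2 y3 s t : glued_paths y1 y2 s -> glued_paths y2 y3 t ->
  glued_dist y1 y3 <= s + t.
Proof.
have LD (y z w : 'rV[R]_d) : L * `|y - w| <= L * `|y - z| + L * `|z - w|.
  by rewrite -mulrDr ler_wpM2l// ler_distD.
move=> [->|[a [b [Aa Ab ->]]]] [->|[a' [b' [Aa' Ab' ->]]]].
- by apply: (le_trans _ (LD y1 y2 y3)); apply: glued_le; left.
- apply: (@le_trans _ _ (L * `|y1 - a'| + mdist (f a') (f b') + L * `|b' - y3|)).
    by apply: glued_le; right; exists a', b'.
  by rewrite !addrA !lerD2r.
- apply: (@le_trans _ _ (L * `|y1 - a| + mdist (f a) (f b) + L * `|b - y3|)).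
    by apply: glued_le; right; exists a, b.
  by rewrite -!addrA !lerD2l.
- apply: (@le_trans _ _ (L * `|y1 - a| + mdist (f a) (f b') + L * `|b' - y3|)).
    by apply: glued_le; right; exists a, b'.
  (* The stretch from [b] to [a'] outside [X] is at least as long as the step from [f b] to [f a'],
     so two passages merge into one. *)
  rewrite !addrA !lerD2r -!addrA !lerD2l.
  have h1 := metric_triangle (f a) (f b) (f b').
  have h2 := metric_triangle (f b) (f a') (f b').
  have h3 := f_lip Ab Aa'; have h4 := LD b y2 a'.
  apply: le_trans h1 _; rewrite lerD2l; apply: le_trans h2 _; rewrite addrA lerD2r.
  exact: le_trans h3 h4.
Qed.

Lemma glued_lip_pseudometric : lip_pseudometric L glued_dist.
Proof.
split => //.
- move=> x; apply/eqP; rewrite eq_le; apply/andP; split; last by apply: le_glued => s /paths_ge0.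
  by apply: glued_le; left; rewrite subrr normr0 mulr0.
- have sym_le x y : glued_dist x y <= glued_dist y x.
    apply: le_glued => s [->|[a [b [Aa Ab ->]]]]; apply: glued_le.
      by left; rewrite distrC.
    right; exists b, a; split => //.
    by rewrite (metric_sym (f b)) (distrC x b) (distrC a y); ring.
  by move=> x y; apply/eqP; rewrite eq_le !sym_le.
- move=> y x z; rewrite -lerBlDr; apply: le_glued => s hs.
  rewrite lerBlDr -lerBlDl; apply: le_glued => t ht.
  by rewrite lerBlDl; exact: paths_triangle hs ht.
- by move=> x y; apply: glued_le; left.
Qed.

Lemma glued_dist_eq y z : A y -> A z -> glued_dist y z = mdist (f y) (f z).
Proof.
move=> Ay Az; apply/eqP; rewrite eq_le; apply/andP; split.
  by apply: glued_le; right; exists y, z; split => //; rewrite !subrr !normr0 mulr0 add0r addr0.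
apply: le_glued => s [->|[a [b [Aa Ab ->]]]]; first exact: f_lip.
apply: le_trans (metric_triangle _ (f b) _) _; apply: lerD; last exact: f_lip.
by apply: le_trans (metric_triangle _ (f a) _) _; apply: lerD => //; exact: f_lip.
Qed.

End gluing.

(** * Fibres over null sets *)

Lemma prod_perturb (R : realType) (I : Type) (s : seq I) (l : I -> R) (e : R) :
  (forall i, 0 <= l i) -> 0 < e -> exists2 r0 : R, 0 < r0 & forall r, 0 < r -> r < r0 ->
    \prod_(i <- s) (l i + r) <= \prod_(i <- s) l i + e.
Proof.
move=> l0; elim: s e => [|i s IH] e e0.
  by exists 1 => // r _ _; rewrite !big_nil lerDl ltW.
have P0 : 0 <= \prod_(k <- s) l k by apply: prodr_ge0.
set P := \prod_(k <- s) l k in IH P0.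
have l1 : 0 < l i + 1 by rewrite ltr_wpDl.
have P1 : 0 < P + 1 by rewrite ltr_wpDl.
have [r1 r10 h1] := IH (e / (2 * (l i + 1))) (divr_gt0 e0 (mulr_gt0 (ltr0Sn R 1) l1)).
exists (Num.min r1 (Num.min 1 (e / (2 * (P + 1))))).
  by rewrite !lt_min r10 ltr01 divr_gt0// mulr_gt0.
move=> r r0; rewrite !lt_min => /and3P[rr1 rr2 rr3]; rewrite !big_cons -/P.
apply: (@le_trans _ _ ((l i + r) * (P + e / (2 * (l i + 1))))).
  by apply: ler_wpM2l; [rewrite addr_ge0// ltW|exact: h1].
rewrite mulrDr mulrDl -addrA lerD2l [e in leRHS]splitr; apply: lerD.
  apply: (@le_trans _ _ (r * (P + 1))); first by rewrite ler_wpM2l ?(ltW r0)// lerDl.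
  rewrite -ler_pdivlMr// (le_trans (ltW rr3))// le_eqVlt; apply/orP; left; apply/eqP.
  by field; rewrite gt_eqF.
apply: (@le_trans _ _ ((l i + 1) * (e / (2 * (l i + 1))))).
  apply: ler_wpM2r; first by rewrite divr_ge0 ?(ltW e0)// mulr_ge0// ltW.
  by rewrite lerD2l ltW.
by rewrite le_eqVlt; apply/orP; left; apply/eqP; field; rewrite gt_eqF.
Qed.

(** A side of length l is cut into floor(l / delta) + 1 intervals, which amounts to enlarging it by
    at most [delta]; by [prod_perturb] this hardly changes the finitely many volumes. One scale for
    all boxes lets the pieces met by a fibre be compared by counting. *)
Lemma finite_boxes_common_scale (R : realType) (d K : nat) (ab : 'I_K -> 'rV[R]_d * 'rV[R]_d)
    (e : R) : (forall i k, (ab i).1 ord0 k <= (ab i).2 ord0 k) -> 0 < e ->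
  exists (delta : R) (J : finType) (p : J -> set 'rV[R]_d),
    [/\ 0 < delta, \bigcup_i box_set (ab i) `<=` \bigcup_j p j,
      forall j y z, p j y -> p j z -> `|y - z| <= delta &
      #|J|%:R * delta ^+ d <= \sum_i box_volume (ab i).1 (ab i).2 + e].
Proof.
move=> abP e0.
have K0 : 0 < K.+1%:R :> R by rewrite ltr0n.
pose l (i : 'I_K) (k : 'I_d) := (ab i).2 ord0 k - (ab i).1 ord0 k.
have l0 i k : 0 <= l i k by rewrite subr_ge0.
have [r0 r00 hr] : exists2 r0 : R, 0 < r0 & forall r, 0 < r -> r < r0 -> forall i,
    \prod_k (l i k + r) <= \prod_k l i k + e / K.+1%:R.
  by apply: common_threshold => i; apply: prod_perturb => //; rewrite divr_gt0.
pose delta := r0 / 2; have delta0 : 0 < delta by rewrite divr_gt0.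
have dr : delta < r0 by rewrite ltr_pdivrMr// ltr_pMr// ltr1n.
pose N (i : 'I_K) (k : 'I_d) := (Num.truncn (l i k / delta)).+1.
pose G (i : 'I_K) : finType := {dffun forall k : 'I_d, 'I_(N i k)}.
pose J : finType := {i : 'I_K & G i}.
pose p (j : J) : set 'rV[R]_d := [set y | box_set (ab (tag j)) y /\
  forall k, Num.truncn ((y ord0 k - (ab (tag j)).1 ord0 k) / delta) = tagged j k :> nat].
exists delta, J, p; split => //.
- move=> y [i _ yi].
  have hk k : (Num.truncn ((y ord0 k - (ab i).1 ord0 k) / delta) < N i k)%N.
    rewrite /N ltnS; apply: le_truncn; rewrite ler_wpM2r ?invr_ge0 ?(ltW delta0)//.
    by rewrite lerD2r; have /andP[] := yi k.
  exists (Tagged G [ffun k => Ordinal (hk k)] : J) => //; split => // k /=.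
  by rewrite ffunE.
- move=> j y z [yb yj] [zb zj]; apply: norm_le_coord; first exact: ltW.
  move=> k; rewrite !mxE; set a := (ab (tag j)).1 ord0 k.
  have y0 : 0 <= (y ord0 k - a) / delta.
    by rewrite divr_ge0 ?(ltW delta0)// subr_ge0; have /andP[] := yb k.
  have z0 : 0 <= (z ord0 k - a) / delta.
    by rewrite divr_ge0 ?(ltW delta0)// subr_ge0; have /andP[] := zb k.
  have /andP[y1 y2] := truncn_itv y0; have /andP[z1 z2] := truncn_itv z0.
  rewrite yj -natr1 in y1 y2; rewrite zj -natr1 in z1 z2.
  have -> : y ord0 k - z ord0 k = ((y ord0 k - a) / delta - (z ord0 k - a) / delta) * delta.
    by field; rewrite gt_eqF.
  rewrite normrM (gtr0_norm delta0) ler_piMl ?(ltW delta0)// ler_norml.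
  move: y1 y2 z1 z2; move: (_ / delta) (_ / delta) => *; apply/andP; split; lra.
- rewrite card_tagged sumnE big_map big_enum /= natr_sum mulr_suml.
  apply: (@le_trans _ _ (\sum_(i < K) (\prod_k l i k + e / K.+1%:R))).
    apply: ler_sum => i _; apply: le_trans (hr delta delta0 dr i).
    rewrite card_dep_ffun foldrE big_map big_enum /= natr_prod.
    rewrite -[X in delta ^+ X](card_ord d) -prodr_const -big_split /=.
    apply: ler_prod => k _; rewrite card_ord mulr_ge0 ?(ltW delta0)//=.
    have q0 : 0 <= l i k / delta by rewrite divr_ge0// ltW.
    have /andP[q1 _] := truncn_itv q0.
    by rewrite /N -natr1 mulrDl mul1r lerD2r -ler_pdivlMr.
  rewrite big_split /= lerD2l sumr_const card_ord -[leLHS]mulr_natl.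
  by rewrite mulrCA ler_piMr ?(ltW e0)// ler_pdivrMr// mul1r ler_nat.
Qed.

(** Take a maximal family of pairwise disjoint sets [H z]. Each has more than M elements, which
    bounds their number, and by maximality every [H z] meets one of them. *)
Lemma disjoint_packing (R : realType) (J : finType) (Z : Type) (H : Z -> {set J})
    (P : set Z) (M : R) : 0 < M -> (forall z, P z -> M < #|H z|%:R) ->
  exists S : {set {set J}}, [/\ forall h, h \in S -> exists2 z, P z & H z = h,
    #|S|%:R * M <= #|J|%:R &
    forall z, P z -> exists h, h \in S /\ exists2 i, i \in H z & i \in h].
Proof.
move=> M0 PM.
pose ok (S : {set {set J}}) := finset.trivIset S && [forall h in S, `[< exists2 z, P z & H z = h >]].
have ok0 : ok finset.set0.
  apply/andP; split; first by apply/finset.trivIsetP => A B; rewrite inE.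
  by apply/forall_inP => h; rewrite inE.
pose S := [arg max_(S > finset.set0 | ok S) #|S|].
have [okS Smax] : ok S /\ forall S', ok S' -> (#|S'| <= #|S|)%N.
  by rewrite /S; case: arg_maxnP.
have /andP[triv /forall_inP memS] := okS.
exists S; split => [h /memS/asboolP//||z Pz].
  apply: (@le_trans _ _ (\sum_(h in S) #|h|%:R)).
    rewrite -mulr_natl mulr1 /= mulrC -sum1_card natr_sum mulr_sumr.
    apply: ler_sum => h /memS/asboolP[z Pz <-]; rewrite mulr1 ltW//; exact: PM.
  by rewrite -natr_sum ler_nat (eqP triv) max_card.
apply: contrapT => hz.
have Hz0 : H z != finset.set0.
  by apply/eqP => h0; have := PM z Pz; rewrite h0 cards0 ltNge ltW.
have disj h : h \in S -> fintype.disjoint (mem (H z)) (mem h).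
  move=> hS; rewrite disjoint_subset; apply/fintype.subsetP => i iH; rewrite inE.
  by apply/negP => ih; apply: hz; exists h; split => //; exists i.
have zS : H z \notin S.
  apply/negP => zS; have := disj _ zS.
  by rewrite -finset.setI_eq0 finset.setIid (negPf Hz0).
have : ok (H z |: S)%SET.
  apply/andP; split.
    apply/finset.trivIsetP => A B; rewrite !inE => /orP[/eqP ->|AS] /orP[/eqP ->|BS].
    - by rewrite eqxx.
    - by move=> _; exact: disj.
    - by move=> _; rewrite disjoint_sym; exact: disj.
    - exact: (finset.trivIsetP triv).
  apply/forall_inP => h; rewrite finset.in_setU1 => /orP[/eqP ->|hS]; last exact: memS.
  by apply/asboolP; exists z.
by move=> /Smax; rewrite cardsU1 zS ltnn.
Qed.

Definition hnull (R : realType) (X : metricType R) (n : nat) :=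
  null (fun E : set X => E) (diam_pow n).

Section eilenberg.
Variables (R : realType) (n m : nat).
Hypotheses (n_gt0 : (0 < n)%N) (m_gt0 : (0 < m)%N).
Local Notation V := 'rV[R]_(n + m).
Variables (X : metricType R) (N : set V) (f : V -> X) (L : R).
Hypothesis L_ge0 : 0 <= L.
Hypothesis f_lip : forall y z, N y -> N z -> mdist (f y) (f z) <= L * `|y - z|.

Definition fiber (z : X) : set (euclidean R (n + m)) := [set y : V | N y /\ f y = z].

Section scale.
Variables (delta : R) (J : finType) (p : J -> set V).
Hypothesis delta_gt0 : 0 < delta.
Hypothesis p_diam : forall j y z, p j y -> p j z -> `|y - z| <= delta.

Definition hits (z : X) : {set J} := [set j | `[< exists y, [/\ N y, p j y & f y = z] >]].

Lemma hitsP z j : reflect (exists y, [/\ N y, p j y & f y = z]) (j \in hits z).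
Proof. by rewrite inE; apply: asboolP. Qed.

Lemma covered_fiber_scale z :
  hcovered m (fiber z `&` \bigcup_j p j)
    (#|hits z|%:R * ((n + m)%:R * delta) ^+ m)%:E.
Proof.
have w0 := @diam_pow_ge0 R (euclidean R (n + m)) m.
have d0 : 0 <= (n + m)%:R * delta by rewrite mulr_ge0// ltW.
pose a (j : J) := if j \in hits z then (((n + m)%:R * delta) ^+ m)%:E else 0%E : \bar R.
have a0 j : (0 <= a j)%E by rewrite /a; case: ifP => // _; rewrite lee_fin exprn_ge0.
have cov (j : J) : hcovered m (fiber z `&` p j) (a j).
  rewrite /a; case: hitsP => hj.
    have := covered1 (fun E : set (euclidean R (n + m)) => E) w0 (diam_pow0 _ m_gt0) (fiber z `&` p j).
    move/covered_sub; apply => //; apply: diam_pow_le => // y y' [_ yj] [_ yj'].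
    apply: le_trans (@euclidean_le_norm R (n + m) y y') _.
    by rewrite ler_wpM2l//; exact: (p_diam yj yj').
  have := covered0 (fun E : set (euclidean R (n + m)) => E) (diam_pow0 _ m_gt0) (lexx 0%E).
  move/covered_sub; apply => // y [[Ny fy] yj]; apply: hj; by exists y.
have /covered_sub := covered_finite w0 (diam_pow0 _ m_gt0) a0 cov; apply.
  by move=> y [yz [j _ yj]]; exists j.
rewrite /a -big_mkcond sumEFin lee_fin sumr_const -[leLHS]mulr_natl.
by [].
Qed.

(** Two values whose fibres hit a common piece are within [L * delta], so the values attached to one
    member of the packing form a set of diameter at most [2 * (L * delta)]; there are at most #|J| /
    M members. *)
Lemma covered_many_hits (M : R) : 0 < M ->
  hcovered n [set z | M < #|hits z|%:R] (#|J|%:R / M * (2 * (L * delta)) ^+ n)%:E.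
Proof.
move=> M0; have w0 := @diam_pow_ge0 R X n.
have Ld : 0 <= L * delta by rewrite mulr_ge0// ltW.
have [S [memS cardS meetS]] := disjoint_packing M0 (fun z (h : [set z | M < #|hits z|%:R] z) => h).
pose a (h : {set J}) := if h \in S then ((2 * (L * delta)) ^+ n)%:E else 0%E : \bar R.
have a0 h : (0 <= a h)%E by rewrite /a; case: ifP => // _; rewrite lee_fin exprn_ge0// mulr_ge0.
pose P (h : {set J}) := [set z | h \in S /\ exists2 i, i \in hits z & i \in h].
have share i z z' : i \in hits z -> i \in hits z' -> mdist z z' <= L * delta.
  move=> /hitsP[y [Ny yi <-]] /hitsP[y' [Ny' yi' <-]].
  by apply: le_trans (f_lip Ny Ny') _; rewrite ler_wpM2l//; exact: p_diam yi yi'.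
have cov h : hcovered n (P h) (a h).
  rewrite /a; case: ifPn => hS.
    have := covered1 (fun E : set X => E) w0 (diam_pow0 _ n_gt0) (P h).
    move/covered_sub; apply => //; apply: diam_pow_le; first by rewrite mulr_ge0.
    have [z0 _ z0h] := memS h hS.
    move=> y y' [_ [i yi ih]] [_ [i' yi' ih']]; rewrite -z0h in ih ih'.
    apply: le_trans (metric_triangle _ z0 _) _; rewrite mulr_natl mulr2n.
    by apply: lerD; [exact: share yi ih|exact: share ih' yi'].
  have := covered0 (fun E : set X => E) (diam_pow0 _ n_gt0) (lexx 0%E).
  by move/covered_sub; apply => // y [hS' _]; rewrite hS' in hS.
have /covered_sub := covered_finite w0 (diam_pow0 _ n_gt0) a0 cov; apply.
  by move=> z Mz; have [h [hS hi]] := meetS z Mz; exists h.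
rewrite /a -big_mkcond sumEFin lee_fin sumr_const -[leLHS]mulr_natl.
apply: ler_wpM2r; first by apply: exprn_ge0; apply: mulr_ge0.
by rewrite ler_pdivlMr.
Qed.

End scale.

(** With at most 2 e delta^-(n + m) pieces and the threshold M = tau delta^-m, the powers of [delta]
    cancel both in the cost of the values with many hits and in that of the other fibres. *)
Lemma block_split (K : nat) (ab : 'I_K -> V * V) (e tau : R) :
  (forall i k, (ab i).1 ord0 k <= (ab i).2 ord0 k) -> 0 < e -> 0 < tau ->
  \sum_i box_volume (ab i).1 (ab i).2 <= e ->
  exists Z : set X, hcovered n Z (2 * (2 * L) ^+ n * (e / tau))%:E /\
    forall z, ~ Z z -> hcovered m (fiber z `&` \bigcup_i box_set (ab i))
      ((n + m)%:R ^+ m * tau)%:E.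
Proof.
move=> abP e0 tau0 vol.
have [delta [J [p [d0 abp pd cardJ]]]] := finite_boxes_common_scale abP e0.
have dm0 : 0 < delta ^+ m by rewrite exprn_gt0.
pose M := tau / delta ^+ m; have M0 : 0 < M by rewrite divr_gt0.
exists [set z | M < #|hits p z|%:R]; split.
  apply: covered_sub (covered_many_hits d0 pd M0) (fun _ h => h) _.
  have -> : #|J|%:R / M * (2 * (L * delta)) ^+ n =
      (#|J|%:R * delta ^+ (n + m)) * ((2 * L) ^+ n / tau).
    rewrite /M mulrA !exprMn exprD; field.
    by rewrite !gt_eqF.
  rewrite lee_fin.
  apply: (@le_trans _ _ ((2 * e) * ((2 * L) ^+ n / tau))).
    apply: ler_wpM2r; first by apply: divr_ge0 (ltW tau0); apply: exprn_ge0; apply: mulr_ge0.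
    by apply: le_trans cardJ _; rewrite mulr_natl mulr2n lerD2r.
  by rewrite le_eqVlt; apply/orP; left; apply/eqP; field; rewrite gt_eqF.
move=> z /negP; rewrite -leNgt => zM.
have /covered_sub := covered_fiber_scale d0 pd z; apply.
  by move=> y [yz /abp yp].
rewrite lee_fin exprMn mulrCA ler_wpM2l ?exprn_ge0//.
by rewrite -ler_pdivlMr.
Qed.

Let beta (j : nat) : R := ((2 ^ j.+1)%:R)^-1.
Let beta_gt0 j : 0 < beta j. Proof. by rewrite invr_gt0 ltr0n expn_gt0. Qed.

Let nneseries_beta (c : R) : 0 <= c -> (\sum_(0 <= j <oo) (c * beta j)%:E <= c%:E)%E.
Proof. exact: (@epsilon_trick0 R c xpredT). Qed.

Hypothesis N_null : box_null N.

(* The tails of a cover of [N] by boxes are made geometrically small, so that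
   each finite block of boxes can be recut at a common scale of its own. *)
Lemma fiber_split (e tau : R) : 0 < e -> 0 < tau ->
  exists Z : set X, hcovered n Z (2 * (2 * L) ^+ n * (e / tau))%:E /\
    forall z, ~ Z z -> hcovered m (fiber z) ((n + m)%:R ^+ m * tau)%:E.
Proof.
move=> e0 tau0.
(* The square is there because block j also uses tau beta_j: the ratio e beta_j^2 / (tau beta_j)
   must still be summable. *)
have eb j : 0 < e * beta j ^+ 2 by rewrite mulr_gt0// exprn_gt0.
have [u [Nu uS]] := N_null (eb 0%N).
have w0 := @box_weight_ge0 R (n + m).
have fin : (\sum_(0 <= k <oo) box_weight (u k) < +oo)%E by rewrite (le_lt_trans uS)// ltry.
have uP k l : (u k).1 ord0 l <= (u k).2 ord0 l.
  have : (box_weight (u k) < +oo)%E.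
    apply: le_lt_trans fin; apply: le_trans (nneseries_lim_ge k.+1 (fun i _ _ => w0 (u i))).
    by rewrite big_nat_recr//= leeDr// sume_ge0.
  by rewrite /box_weight; case: forallP.
have uW k : box_weight (u k) = (box_volume (u k).1 (u k).2)%:E.
  by rewrite /box_weight; case: forallP => // -[] l; exact: uP.
pose tail b := (\sum_(b <= k <oo) box_weight (u k))%E.
have tailP j : exists T, forall k, (T <= k)%N -> (tail k <= (e * beta j.+1 ^+ 2)%:E)%E.
  have cv := nneseries_tail_cvg fin (fun k _ => w0 (u k)).
  have e1 : (0%E < (e * beta j.+1 ^+ 2)%:E)%E by rewrite lte_fin.
  have [T _ hT] := cv _ (open_ereal_lt' e1).
  by exists T => k Tk; apply: ltW; exact: (hT k Tk).
have /choice[T TP] := tailP.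
(* Start of block j: beyond all thresholds up to the one for tail j, and at least j, so that the
   blocks exhaust the cover. *)
pose b j := if j is j'.+1 then ((\max_(i < j) T i) + j)%N else 0%N.
have b_tail j : (tail (b j) <= (e * beta j ^+ 2)%:E)%E.
  case: j => [|j]; first exact: uS.
  apply: TP; rewrite /b (leq_trans _ (leq_addr _ _))//.
  exact: (@leq_bigmax _ (fun i : 'I_j.+1 => T i) ord_max).
have b_mono j : (b j <= b j.+1)%N.
  by case: j => [//|j]; rewrite /b [X in (_ <= X + _)%N]big_ord_recr /= leq_add// leq_maxl.
pose blk j (i : 'I_(b j.+1 - b j)) := u (i + b j)%N.
have vol j : \sum_i box_volume (blk j i).1 (blk j i).2 <= e * beta j ^+ 2.
  rewrite -lee_fin; apply: le_trans (b_tail j).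
  rewrite -sumEFin; apply: le_trans (nneseries_lim_ge (b j.+1) (fun i _ _ => w0 (u i))).
  rewrite -[X in index_iota X]add0n big_addn big_mkord le_eqVlt; apply/orP; left; apply/eqP.
  by apply: eq_bigr => i _; rewrite uW.
have /choice[Z ZP] j := block_split (fun i k => uP _ k) (eb j) (mulr_gt0 tau0 (beta_gt0 j)) (vol j).
have q0 : 0 <= 2 * (2 * L) ^+ n * (e / tau).
  by rewrite !mulr_ge0 ?exprn_ge0 ?mulr_ge0 ?invr_ge0// ltW.
exists (\bigcup_j Z j); split.
  have /covered_sub := covered_bigcup (@diam_pow_ge0 R X n) (fun j => (ZP j).1); apply => //.
  apply: le_trans (nneseries_beta q0); apply: lee_nneseries => j _.
    move=> _; rewrite lee_fin; apply: mulr_ge0.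
      by apply: mulr_ge0 => //; apply: exprn_ge0; exact: mulr_ge0.
    by apply: divr_ge0; [exact: ltW|apply: ltW; exact: mulr_gt0].
  rewrite lee_fin le_eqVlt; apply/orP; left; apply/eqP; field.
  by rewrite !gt_eqF.
move=> z nZ.
have cov j : hcovered m (fiber z `&` \bigcup_i box_set (blk j i)) ((n + m)%:R ^+ m * tau * beta j)%:E.
  by rewrite -mulrA; apply: (ZP j).2 => Zj; apply: nZ; exists j.
have q1 : 0 <= (n + m)%:R ^+ m * tau by rewrite mulr_ge0 ?exprn_ge0// ltW.
have /covered_sub := covered_bigcup (@diam_pow_ge0 R (euclidean R (n + m)) m) cov; apply.
  move=> y yz; have [k _ yk] := Nu y yz.1.
  have exj : exists j, (k < b j.+1)%N by exists k; rewrite /b ltn_addl.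
  case: (ex_minnP exj) => j kj jmin; exists j => //; split => //.
  have bk : (b j <= k)%N.
    by case: j kj jmin => // j _ jmin; rewrite leqNgt; apply/negP => /jmin; rewrite ltnn.
  have kb : (k - b j < b j.+1 - b j)%N by rewrite ltn_sub2r// (leq_ltn_trans bk).
  by exists (Ordinal kb) => //; rewrite /blk /= subnK.
exact: nneseries_beta.
Qed.

(** For a fixed bound [tau = 4 ^- i] on the fibres, the exceptional set costs a multiple of e / tau
    with e arbitrary, so it is null; the union over i is countable. *)
Theorem eilenberg_null : hnull n [set z | ~ hnull m (fiber z)].
Proof.
pose c : R := (n + m)%:R ^+ m.
pose W i := [set z | ~ hcovered m (fiber z) (c * 4 ^- i)%:E].
apply: (@null_sub _ _ _ _ _ (\bigcup_i W i)); last first.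
  move=> z; apply: contra_notP => nW e e0.
  have c0 : 0 < c + 1 by rewrite ltr_wpDl ?exprn_ge0.
  have [i hi] := pow4_small (divr_gt0 e0 c0).
  have hz : hcovered m (fiber z) (c * 4 ^- i)%:E by apply: contrapT => h; apply: nW; exists i.
  apply: covered_sub hz (fun _ h => h) _; rewrite lee_fin.
  rewrite ler_pdivlMr// mulrC in hi; apply: le_trans hi.
  by rewrite ler_wpM2r ?lerDl// invr_ge0 exprn_ge0.
apply: null_bigcup; first exact: diam_pow_ge0.
move=> i e e0; have t0 : 0 < 4 ^- i :> R by rewrite invr_gt0 exprn_gt0.
pose q : R := 2 * (2 * L) ^+ n + 1.
have q0 : 0 < q by rewrite ltr_wpDl// mulr_ge0// exprn_ge0// mulr_ge0.
have [Z [cZ nZ]] := fiber_split (mulr_gt0 (divr_gt0 e0 q0) t0) t0.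
apply: covered_sub cZ _ _.
  by move=> z; apply: contra_notP => /nZ.
rewrite lee_fin mulfK ?gt_eqF// mulrCA ler_piMr ?(ltW e0)// ler_pdivrMr// mul1r.
by rewrite lerDl.
Qed.

End eilenberg.

(** * Rectifiability of the fibres *)

Lemma diam_pow_le_inv (R : realType) (X : metricType R) (n : nat) (E : set X) (r : R) :
  (0 < n)%N -> 0 < r -> (diam_pow n E <= (r ^+ n)%:E)%E -> (diam E <= r%:E)%E.
Proof.
move=> n0 r0; rewrite /diam_pow; have := diam_ge0 E; case: (diam E) => [s| |]//.
  by rewrite -EFin_expe !lee_fin => s0; rewrite ler_pXn2r// nnegrE// ltW.
move=> _; case: n n0 => // n _.
suff -> : ((+oo : \bar R) ^+ n.+1 = +oo)%E by [].
by elim: n => // n IH; rewrite expeS IH mulyy.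
Qed.

(** A cover of total weight at most r^n consists of sets of diameter at most r, so covers of small
    total weight are admissible in the premeasure at every scale. *)
Lemma hnull_hausdorff_measure (R : realType) (X : metricType R) (n : nat) (E : set X) :
  (0 < n)%N -> hnull n E -> hausdorff_measure n E = 0%E.
Proof.
move=> n0 E0; have om := omega_ge0 R n.
set c := omega R n / 2 ^+ n; have c0 : 0 <= c by rewrite divr_ge0 ?exprn_ge0.
have pre0 (r : R) : 0 < r -> hausdorff_premeasure n r E = 0%E.
  move=> r0; apply/eqP; rewrite eq_le; apply/andP; split; last first.
    apply: le_ereal_inf_tmp => _ [u [Eu _] <-].
    apply: mule_ge0; first by rewrite lee_fin.
    by apply: nneseries_ge0 => k _ _; exact: diam_pow_ge0.
  apply/lee_addgt0Pr => e e0; rewrite add0e.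
  have c1 : 0 < c + 1 by rewrite ltr_wpDl.
  have m0 : 0 < Num.min (r ^+ n) (e / (c + 1)) by rewrite lt_min exprn_gt0//= divr_gt0.
  have [u [Eu uS]] := E0 _ m0.
  apply: le_trans (ereal_inf_lbound _) _.
    exists u; last by [].
    split => // k; apply: (diam_pow_le_inv n0 r0).
    have h := le_trans (nneseries_lim_ge (m := 0) (P := xpredT) k.+1
      (fun i _ _ => diam_pow_ge0 n (u i))) uS.
    rewrite big_nat_recr//= in h.
    apply: (@le_trans _ _ (Num.min (r ^+ n) (e / (c + 1)))%:E); last first.
      by rewrite lee_fin ge_min lexx.
    apply: le_trans h; rewrite leeDr// sume_ge0// => i _; exact: diam_pow_ge0.
  rewrite /cover_size -/c; apply: le_trans (lee_wpmul2l _ uS) _; first by rewrite lee_fin.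
  rewrite -EFinM lee_fin; apply: (@le_trans _ _ (c * (e / (c + 1)))).
    by rewrite ler_wpM2l// ge_min lexx orbT.
  by rewrite mulrCA ler_piMr ?(ltW e0)// ler_pdivrMr// mul1r lerDl.
rewrite /hausdorff_measure (_ : [set _ | _ in _] = [set 0%E]) ?ereal_sup1//.
apply/seteqP; split => [_ [r r0 <-]|_ ->]; first by rewrite /= pre0.
by exists 1; [exact: ltr01|rewrite pre0].
Qed.

Section charts.
Variables (R : realType) (n m : nat) (X : metricType R).
Hypotheses (n_gt0 : (0 < n)%N) (m_gt0 : (0 < m)%N).
Local Notation d := (n + m)%N.
Local Notation V := 'rV[R]_d.
Variables (A : set V) (f : V -> X) (D : V -> V -> R) (L : R).
Hypothesis HD : lip_pseudometric L D.
Hypothesis fD : forall y z, A y -> A z -> D y z = mdist (f y) (f z).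

Definition has_chart (I : {ffun 'I_m -> 'I_d}) (K : nat) (x : V) :=
  forall y (r : R), `|y - x| <= 4 ^- K -> D x y = 0 -> 0 <= r ->
    (forall l, `|y ord0 (I l) - x ord0 (I l)| <= r) -> `|y - x| <= K%:R * r.

Lemma chart_of_density x : (forall v, md_at D x v) ->
  (0 < upper_density n (A : set (euclidean R d)) f x)%E ->
  exists I K, has_chart I K x.
Proof.
move=> md dens.
have [B BK] := linear_pred_row_space (@kernel0 R d L D HD x) (kernelD HD md)
  (fun a v => @kernelZ R d L D HD x md a v).
have rB : (\rank B <= m)%N.
  rewrite leqNgt; apply/negP => mB.
  apply: (@upper_density_collapsed R d n X A f x _ dens) => e e0.
  apply: (collapsed_cover HD _ md BK n_gt0 _ e0); first by move=> y z Ay Az; rewrite fD.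
  by rewrite ltn_add2l.
have [I sepI] := row_space_chart (Ordinal (ltn_addr m n_gt0)) rB.
have [K hK] : exists K : nat, forall y (r : R), `|y - x| <= 4 ^- K -> D x y = 0 -> 0 <= r ->
    (forall l, `|y ord0 (I l) - x ord0 (I l)| <= r) -> `|y - x| <= K%:R * r.
  apply: (level_chart HD md) => v /BK vB; exact: sepI.
exists [ffun l => I l], K => y r h1 h2 h3 h4; apply: hK => // l.
by have := h4 l; rewrite ffunE.
Qed.

Local Notation index := ({ffun 'I_m -> 'I_d} * nat * {ffun 'I_d -> int})%type.

(** Fixing the grid cell of level K keeps the points of a piece within 4^-K of each other, the range
    in which [has_chart] applies. The same K is the Lipschitz constant. *)
Definition chart_piece (z : X) (i : index) : set V :=
  [set x | [/\ A x, f x = z, has_chart i.1.1 i.1.2 x &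
     shift_cell [ffun=> false] i.1.2 x = i.2]].

Definition chart_proj (i : index) (x : V) : 'rV[R]_m := \row_l x ord0 (i.1.1 l).

(** The inverse of the projection on the piece; off the image of the piece it takes the default
    value 0. *)
Definition chart_inv (z : X) (i : index) (p : 'rV[R]_m) : V :=
  xget 0 [set x | chart_piece z i x /\ chart_proj i x = p].

Lemma chart_pieceP z i x y : chart_piece z i x -> chart_piece z i y ->
  `|y - x| <= i.1.2%:R * `|chart_proj i y - chart_proj i x|.
Proof.
move=> [Ax fx cx ix] [Ay fy cy iy]; apply: cx => //.
- by apply: (@shift_cell_near _ _ [ffun=> false]); rewrite iy.
- by rewrite fD// fx fy mdistxx.
- by move=> l; have := coord_le_norm (chart_proj i y - chart_proj i x) l; rewrite !mxE.
Qed.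

Lemma chart_invP z i p : (chart_proj i @` chart_piece z i) p ->
  chart_piece z i (chart_inv z i p) /\ chart_proj i (chart_inv z i p) = p.
Proof.
move=> [x xi xp].
exact: (@xgetPex _ 0 [set x | chart_piece z i x /\ chart_proj i x = p] (ex_intro _ x (conj xi xp))).
Qed.

Lemma chart_invK z i x : chart_piece z i x -> chart_inv z i (chart_proj i x) = x.
Proof.
move=> xi; have [yi yp] : chart_piece z i (chart_inv z i (chart_proj i x)) /\
    chart_proj i (chart_inv z i (chart_proj i x)) = chart_proj i x.
  by apply: chart_invP; exists x.
have := chart_pieceP xi yi; rewrite yp subrr normr0 mulr0 normr_le0 subr_eq0.
by move/eqP.
Qed.

Lemma chart_inv_lipschitz z i : @lipschitz_within R (euclidean R m) (euclidean R d)
  (chart_proj i @` chart_piece z i) (chart_inv z i).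
Proof.
exists (d%:R * i.1.2%:R) => p q /chart_invP[pi pp] /chart_invP[qi qq].
apply: le_trans (euclidean_le_norm _ _) _; rewrite -mulrA ler_wpM2l//.
apply: le_trans (chart_pieceP qi pi) _; rewrite pp qq ler_wpM2l//.
exact: norm_le_euclidean.
Qed.

Lemma rectifiable_fiber (N : set V) z :
  (forall x, A x -> ~ N x -> exists I K, has_chart I K x) ->
  hnull m ([set y : V | N y /\ f y = z] : set (euclidean R d)) ->
  countably_rectifiable m ((A : set (euclidean R d)) `&` f @^-1` [set z]).
Proof.
move=> charts N0.
exists (fun k => if unpickle k is Some i then chart_proj i @` chart_piece z i else set0).
exists (fun k => if unpickle k is Some i then chart_inv z i else fun=> 0).
split.
  move=> k; case: unpickle => [i|]; first exact: chart_inv_lipschitz.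
  by exists 0 => x y [].
apply: hnull_hausdorff_measure => //; apply: null_sub N0 _ => x [[Ax fx] nx].
split => //; apply: contrapT => nN; apply: nx.
have [I [K ch]] := charts x Ax nN.
pose i : index := (I, K, shift_cell [ffun=> false] K x).
have xi : chart_piece z i x by [].
exists (pickle i) => //; rewrite pickleK; exists (chart_proj i x); first by exists x.
exact: chart_invK.
Qed.

End charts.

Theorem corollary1p8 (R : realType) (n m : nat)
    (n_ge1 : (1 <= n)%N) (m_ge1 : (1 <= m)%N)
    (X : metricType R) (A : set (euclidean R (n + m)))
    (f : euclidean R (n + m) -> X)
    (A_meas : lebesgue_measurable A) (A_pos : (0 < lebesgue_outer A)%E)
    (f_lip : lipschitz_within A f)
    (density_pos :
      lebesgue_outer (A `&` [set x | ~ (0 < upper_density n A f x)%E]) = 0%E) :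
  hausdorff_measure n
    [set z : X | ~ countably_rectifiable m (A `&` f @^-1` [set z])] = 0%E.
Proof.
have d_gt0 : (0 < n + m)%N by rewrite addn_gt0 n_ge1.
have [L0 hL0] := f_lip.
(* The factor n + m passes from the Euclidean distance to the sup norm; the absolute value covers a
   negative [L0]. *)
pose L : R := `|L0| * (n + m)%:R.
have L_ge0 : 0 <= L by rewrite mulr_ge0.
have fL (y z : 'rV[R]_(n + m)) : A y -> A z -> mdist (f y) (f z) <= L * `|y - z|.
  move=> Ay Az; apply: le_trans (hL0 y z Ay Az) _.
  apply: (@le_trans _ _ (`|L0| * mdist (y : euclidean R (n + m)) z)).
    by rewrite ler_wpM2r ?mdist_ge0// ler_norm.
  by rewrite /L -mulrA ler_wpM2l//; exact: euclidean_le_norm.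
have HD := glued_lip_pseudometric L_ge0 fL.
have fD := glued_dist_eq L_ge0 fL.
(* The exceptional points of [A]; at all others [chart_of_density] applies. *)
pose N : set 'rV[R]_(n + m) := [set x | A x /\
  ((exists v, ~ md_at (glued_dist A f L) x v) \/ ~ (0 < upper_density n A f x)%E)].
have N_null : box_null N.
  apply: null_sub (nullU (@box_weight_ge0 R (n + m)) (box_weight0 R d_gt0)
    (md_at_null HD d_gt0) (lebesgue_outer0_null density_pos)) _.
  by move=> x [Ax [h|h]]; [left|right].
have fLN (y z : 'rV[R]_(n + m)) : N y -> N z -> mdist (f y) (f z) <= L * `|y - z|.
  by move=> [Ay _] [Az _]; exact: fL.
have nullZ := eilenberg_null n_ge1 m_ge1 L_ge0 fLN N_null.
apply: hnull_hausdorff_measure => //; apply: null_sub nullZ _ => z.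
apply: contra_not => fiber0; apply: (rectifiable_fiber m_ge1 fD _ fiber0) => x Ax nN.
have md v : md_at (glued_dist A f L) x v.
  by apply: contrapT => h; apply: nN; split => //; left; exists v.
apply: (chart_of_density n_ge1 HD fD md).
by apply: contrapT => h; apply: nN; split => //; right.
Qed.
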